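(* Let $(Y(u,n))$, $n\in\mathbb N$, $u\in\mathcal U=[t]$, be a family of complex $n\times n$ random matrices such that, for each $n$, $\{\mathrm{Re}\,Y_{i,j}(u,n),\mathrm{Im}\,Y_{i,j}(u,n):i,j\in[n],u\in\mathcal U\}$ is a family of independent Gaussian random variables with zero mean and variances $$\mathbb E\big((\mathrm{Re}\,Y_{i,j}(u,n))^2\big)=\mathbb E\big((\mathrm{Im}\,Y_{i,j}(u,n))^2\big)=\frac{v_{p,q}(u)}{2n}$$ for any $(i,j)\in N_p\times N_q$ and $u\in\mathcal U$, where the matrices $(v_{p,q}(u))$ are symmetric. Then $$\lim_{n\to\infty}\tau_q(n)\big(T_{p_1,q_1}^{\,\epsilon_1}(u_1,n)\cdots T_{p_m,q_m}^{\,\epsilon_m}(u_m,n)\big)=\Psi_q\big(\eta_{p_1,q_1}^{\epsilon_1}(u_1)\cdots\eta_{p_m,q_m}^{\epsilon_m}(u_m)\big)$$ for any $m\in\mathbb N$, $\epsilon_1,\dots,\epsilon_m\in\{1,*\}$, $u_1,\dots,u_m\in\mathcal U$ and $q,p_1,q_1,\dots,p_m,q_m\in[r]$.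
   Context: Random matrices. Fix $r,t\in\mathbb N$, $[k]=\{1,\dots,k\}$. For each $n$ let $[n]$ be partitioned into disjoint nonempty intervals $N_1,\dots,N_r$ (depending on $n$), $n_q=|N_q|$, with $\lim_{n\to\infty}n_q/n=d_q\ge 0$ for each $q$ (some $d_q$ may be $0$). $D_q$ is the $n\times n$ diagonal matrix with $(D_q)_{j,j}=1$ if $j\in N_q$ and all other entries $0$. $\tau_q(n)(A)=\frac1{n_q}\mathbb E\sum_{j\in N_q}A_{j,j}$. Symmetric blocks: $T_{q,q}(u,n)=D_qY(u,n)D_q$ and $T_{p,q}(u,n)=D_pY(u,n)D_q+D_qY(u,n)D_p$ for $p\ne q$; $T^*$ is the adjoint. Operators. $\mathcal M$ is the Hilbert space with orthonormal basis consisting of vacuum vectors $\Omega_1,\dots,\Omega_r$ and all simple tensors $e_{p_1,p_2}(u_1)\otimes e_{p_2,p_3}(u_2)\otimes\cdots\otimes e_{p_m,q}(u_m)$ with $m\ge1$, $p_1,\dots,p_m,q\in[r]$, $u_1,\dots,u_m\in[2t]$. $\Psi_q(a)=\langle a\Omega_q,\Omega_q\rangle$. For $p,q\in[r]$ and $u\in[2t]$ the matricially free creation operator $\wp_{p,q}(u)$ with covariance $b_{p,q}(u)\ge0$ is given by $\wp_{p,q}(u)\Omega_q=\sqrt{b_{p,q}(u)}\,e_{p,q}(u)$, $\wp_{p,q}(u)(e_{q,s}(v)\otimes w)=\sqrt{b_{p,q}(u)}\,e_{p,q}(u)\otimes e_{q,s}(v)\otimes w$ for every basis vector $e_{q,s}(v)\otimes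 w$, and zero on all other basis vectors. Here $b_{p,q}(2u-1)=b_{p,q}(2u)=d_pv_{p,q}(u)$ for $u\in[t]$. Symmetrized creation operators: $\widehat\wp_{q,q}(u)=\wp_{q,q}(u)$, $\widehat\wp_{p,q}(u)=\wp_{p,q}(u)+\wp_{q,p}(u)$ for $p\ne q$. Finally $\eta_{p,q}(u)=\widehat\wp_{p,q}(2u-1)+\widehat\wp_{p,q}(2u)^*$ for $p,q\in[r]$, $u\in[t]$. *)

(* Defs.v *)
From HB Require Import structures.
From mathcomp Require Import all_boot all_order all_algebra.
From mathcomp Require Import all_classical all_reals all_analysis.
From mathcomp Require Import complex ring lra.

Set Implicit Arguments.
Unset Strict Implicit.
Unset Printing Implicit Defensive.

Import Order.TTheory GRing.Theory Num.Theory.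
Import numFieldNormedType.Exports.

Local Open Scope classical_set_scope.
Local Open Scope complex_scope.
Local Open Scope ring_scope.

(* [Re] and [Im] are the coordinates of [R[i]], with values in [R]; they are
   not [Num.Re] and [Num.Im], whose values are in [R[i]]. *)
Local Notation Re := complex.Re.
Local Notation Im := complex.Im.

Section ell2.
Variables (R : realType) (I : choiceType).
Local Notation C := R[i].

Definition sqnormc (z : C) : R := Re z ^+ 2 + Im z ^+ 2.

Lemma sqnormc_ge0 z : 0 <= sqnormc z.
Proof. by rewrite addr_ge0 ?sqr_ge0. Qed.

Lemma sqnormcM x y : sqnormc (x * y) = sqnormc x * sqnormc y.
Proof. by case: x y => [a b] [c d]; rewrite /sqnormc/=; ring. Qed.

Lemma sqnormcD x y : sqnormc (x + y) <= 2 * sqnormc x + 2 * sqnormc y.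
Proof.
case: x y => [a b] [c d]; rewrite /sqnormc/=.
have := sqr_ge0 (a - c); have := sqr_ge0 (b - d); nra.
Qed.

Definition square_summable : {pred I -> C} :=
  fun f => `[< (\esum_(w in [set: I]) (sqnormc (f w))%:E < +oo)%E >].

Lemma esumZ_le (c : R) (a : I -> R) : 0 <= c ->
  (\esum_(w in [set: I]) (c * a w)%:E <=
   c%:E * \esum_(w in [set: I]) (a w)%:E)%E.
Proof.
move=> c0; rewrite ge_ereal_sup => //= _ [X [finX XI]] <-.
rewrite (_ : (\sum_(x \in X) (c * a x)%:E)%E =
             (c%:E * \sum_(x \in X) (a x)%:E)%E); last first.
  by rewrite !fsbig_finite//= !sumEFin -EFinM mulr_sumr.
by rewrite lee_wpmul2l ?lee_fin// esum_ge//; exists X.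
Qed.

Lemma square_summable_le (c : R) (f g : I -> C) : 0 <= c ->
  (\esum_(w in [set: I]) (sqnormc (g w))%:E <=
   c%:E * \esum_(w in [set: I]) (sqnormc (f w))%:E)%E ->
  f \in square_summable -> g \in square_summable.
Proof.
move=> c0 gf /asboolP ff; apply/asboolP; apply: (le_lt_trans gf).
by rewrite lte_mul_pinfty ?lee_fin.
Qed.

Lemma square_summable_submod_closed : submod_closed square_summable.
Proof.
split.
  apply/asboolP; rewrite esum1 ?ltry// => w _.
  by rewrite /sqnormc /= expr0n /= addr0.
move=> a f g ff /asboolP gg; apply/asboolP.
have /asboolP af : (fun w => a * f w) \in square_summable.
  apply: (@square_summable_le (sqnormc a) f) => //; first exact: sqnormc_ge0.
  by under eq_esum do rewrite sqnormcM; exact: esumZ_le (sqnormc_ge0 a).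
have: ((2%:E * (\esum_(w in [set: I]) (sqnormc (a * f w))%:E +
       \esum_(w in [set: I]) (sqnormc (g w))%:E)) < +oo :> \bar R)%E.
  by rewrite lte_mul_pinfty// ?lee_fin// lte_add_pinfty.
apply: le_lt_trans; rewrite -esumD; first last.
- by move=> w _; rewrite lee_fin sqnormc_ge0.
- by move=> w _; rewrite lee_fin sqnormc_ge0.
apply: le_trans (esumZ_le _ _) => //; apply: le_esum => w _.
by rewrite lee_fin mulrDr; exact: sqnormcD.
Qed.

HB.instance Definition _ :=
  GRing.isSubmodClosed.Build _ _ square_summable square_summable_submod_closed.

Record ell2 := Ell2 {
  ell2_val :> I -> C;
  ell2_valP : ell2_val \in square_summable }.

HB.instance Definition _ := [isSub for ell2_val].
HB.instance Definition _ := [Choice of ell2 by <:].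
HB.instance Definition _ := [SubChoice_isSubLmodule of ell2 by <:].

Lemma ket_subproof (w : I) :
  (fun w' => (w' == w)%:R : C) \in square_summable.
Proof.
apply/asboolP.
rewrite (_ : \esum_(w' in _) _ = \esum_(w' in [set w]) (1 : R)%:E).
  by rewrite esum_set1 ?ltry.
rewrite [RHS]esum_mkcond; apply: eq_esum => w' _.
have [->|ww'] := eqVneq w' w; rewrite /sqnormc/=.
  by rewrite mem_set//= expr1n expr0n/= addr0.
by rewrite memNset ?expr0n ?addr0//= => /eqP; apply/negP.
Qed.

Definition ket (w : I) : ell2 := Ell2 (ket_subproof w).

(* The sum of an absolutely summable family of real, resp. complex, numbers. *)
Definition rsum (f : I -> R) : R :=
  fine (\esum_(w in [set: I]) (f^\+ w)%:E) -
  fine (\esum_(w in [set: I]) (f^\- w)%:E).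
Definition csum (f : I -> C) : C := 
  rsum (fun w => Re (f w)) +i* rsum (fun w => Im (f w)).

Definition dot (f g : ell2) : C := csum (fun w => f w * conjc (g w)).

Definition is_adjoint (A B : ell2 -> ell2) : Prop :=
  forall f g, dot (A f) g = dot f (B g).

(* Such a [B] is unique; it exists when [A] is linear and bounded. *)
Definition adjoint (A : ell2 -> ell2) : ell2 -> ell2 :=
  xget (fun=> 0) [set B | is_adjoint A B].

End ell2.

Section operators.
Variables (R : realType) (r k : nat).
Local Notation C := R[i].

(* The orthonormal basis of $\mathcal M$ for labels in [k]: the pair
   ([:: (p_1, u_1); ...; (p_m, u_m)], q) stands for the simple tensor
   e_{p_1,p_2}(u_1) (x) e_{p_2,p_3}(u_2) (x) ... (x) e_{p_m,q}(u_m)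
   if m > 0, and for the vacuum vector Omega_q if m = 0. *)
Definition fock_basis := (seq ('I_r * 'I_k) * 'I_r)%type.

HB.instance Definition _ := Choice.on fock_basis.

Definition fock := ell2 R fock_basis.

Definition vacuum (q : 'I_r) : fock := ket R (([::], q) : fock_basis).

(* The first index p_1 of a simple tensor, and q for Omega_q. *)
Definition head_index (w : fock_basis) : 'I_r :=
  if w.1 is (p, _) :: _ then p else w.2.

Definition prepend (p : 'I_r) (u : 'I_k) (w : fock_basis) : fock_basis :=
  ((p, u) :: w.1, w.2).

(* Coefficientwise form of the bounded operator acting on basis vectors as in
   [creation_ket] below. *)
Definition creation_fun (b : R) (p q : 'I_r) (u : 'I_k)
    (f : fock) (w : fock_basis) : C :=
  if w is (x :: s, q0) then
    if (x == (p, u)) && (head_index (s, q0) == q)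
    then (Num.sqrt b)%:C * f (s, q0) else 0
  else 0.

Lemma creation_subproof b p q u f :
  creation_fun b p q u f \in @square_summable R fock_basis.
Proof.
apply: (@square_summable_le _ _ (sqnormc (Num.sqrt b)%:C) f);
  [exact: sqnormc_ge0| |exact: ell2_valP].
set c := sqnormc _.
have c0 : 0 <= c by exact: sqnormc_ge0.
apply: (@le_trans _ _ (\esum_(w in [set: fock_basis]) (c * sqnormc (f w))%:E)%E);
  last exact: esumZ_le.
rewrite [leRHS](_ : _ = \esum_(w in prepend p u @` [set: fock_basis])
    (c * sqnormc (f (behead w.1, w.2)))%:E)%E; last first.
  rewrite esum_image; first by apply: eq_esum => -[].
  by move=> [s1 q1] [s2 q2] _ _ [-> ->].
rewrite [leRHS]esum_mkcond; apply: le_esum => -[s q0] _ /=.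
case: ifPn => [_|sq].
  case: s => [|x s] /=; first by rewrite /sqnormc/= expr0n addr0 lee_fin mulr_ge0 ?sqnormc_ge0.
  case: ifPn => _; first by rewrite -sqnormcM.
  by rewrite {1}/sqnormc/= expr0n addr0 lee_fin mulr_ge0 ?sqnormc_ge0.
case: s sq => [|x s] /=; first by rewrite /sqnormc/= expr0n addr0.
case: ifPn => [/andP[/eqP -> _]|]; last by rewrite /sqnormc/= expr0n addr0.
by move=> /negP[]; rewrite inE; exists (s, q0).
Qed.

Definition creation (b : 'I_r -> 'I_r -> 'I_k -> R) (p q : 'I_r) (u : 'I_k)
    (f : fock) : fock :=
  Ell2 (creation_subproof (b p q u) p q u f).

Lemma creation_ket b p q u w :
  creation b p q u (ket R w) =
  if head_index w == q
  then (Num.sqrt (b p q u))%:C *: ket R (prepend p u w) else 0.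
Proof.
have scaleE (c : C) (g : fock) w' : (c *: g) w' = c * g w' by [].
apply/val_inj/funext => -[[|x s] q0] /=.
  by case: ifP => _ //; rewrite scaleE /= mulr0.
case: w => s' q1; have [->|xpu] := eqVneq x (p, u); last first.
  case: ifP => _ //; rewrite scaleE /=.
  by rewrite xpair_eqE eqseq_cons (negbTE xpu) mulr0.
have [[-> ->]|ne] := eqVneq ((s, q0) : fock_basis) (s', q1).
  by rewrite andTb; case: ifP => _ //; rewrite scaleE /= !eqxx.
rewrite mulr0 if_same; case: ifP => _ //; rewrite scaleE /=.
rewrite xpair_eqE eqseq_cons eqxx/=.
by move: ne; rewrite xpair_eqE => /negbTE ->; rewrite mulr0.
Qed.

Definition sym_creation b (p q : 'I_r) (u : 'I_k) : fock -> fock :=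
  if p == q then creation b q q u
  else fun f => creation b p q u f + creation b q p u f.

Definition Psi (q : 'I_r) (a : fock -> fock) : C :=
  dot (a (vacuum q)) (vacuum q).

End operators.

Section eta.
Variables (R : realType) (r t : nat).
Local Notation C := R[i].

Lemma odd_label_subproof (u : 'I_t) : (u.*2 < t.*2)%N.
Proof. by rewrite ltn_double. Qed.

Lemma even_label_subproof (u : 'I_t) : (u.*2.+1 < t.*2)%N.
Proof. by rewrite ltn_Sdouble. Qed.

Lemma half_label_subproof (w : 'I_t.*2) : (w./2 < t)%N.
Proof. by rewrite ltn_half_double. Qed.

(* The labels 2u-1 and 2u of [2t] for u in [t], shifted to 0-based indices,
   and the map sending both of them to u. *)
Definition odd_label (u : 'I_t) : 'I_t.*2 := Ordinal (odd_label_subproof u).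
Definition even_label (u : 'I_t) : 'I_t.*2 := Ordinal (even_label_subproof u).
Definition half_label (w : 'I_t.*2) : 'I_t := Ordinal (half_label_subproof w).

Definition covariance (d : 'I_r -> R) (v : 'I_t -> 'M[R]_r)
    (p q : 'I_r) (w : 'I_t.*2) : R := d p * v (half_label w) p q.

Definition eta (d : 'I_r -> R) (v : 'I_t -> 'M[R]_r) (p q : 'I_r) (u : 'I_t)
    (f : fock R r t.*2) : fock R r t.*2 :=
  sym_creation (covariance d v) p q (odd_label u) f +
  adjoint (sym_creation (covariance d v) p q (even_label u)) f.

(* The exponent is 1 for [false] and * for [true], here and in [block_pow]. *)
Definition eta_pow (e : bool) d v p q u :=
  if e then adjoint (eta d v p q u) else eta d v p q u.

End eta.

Section random.
Variables (R : realType) (d : measure_display) (T : measurableType d).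
Variable P : probability T R.

(* [normal_prob m s] is the normal law only for s != 0; a Gaussian variable of
   variance 0 is almost surely constant. *)
Definition gaussian (X : T -> R) : Prop :=
  measurable_fun [set: T] X /\
  exists m s : R, forall A : set R, measurable A ->
    P (X @^-1` A) = if s == 0 then \d_m A else normal_prob m s A.

Definition mutually_independent (I : finType) (X : I -> T -> R) : Prop :=
  forall (J : {set I}) (A : I -> set R), (forall i, measurable (A i)) ->
    P (\bigcap_(i in [set` J]) (X i @^-1` A i)) =
    (\prod_(i in J) P (X i @^-1` A i))%E.

Definition cexpectation (Z : T -> R[i]) : R[i] :=
  fine 'E_P[fun x => Re (Z x)] +i* fine 'E_P[fun x => Im (Z x)].

Definition tau n (A : {set 'I_n}) (M : T -> 'M[R[i]]_n) : R[i] :=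
  #|A|%:R^-1 * cexpectation (fun x => \sum_(j in A) M x j j).

Definition entry_part n (b : bool) (M : T -> 'M[R[i]]_n) (i j : 'I_n) (x : T) : R :=
  if b then Im (M x i j) else Re (M x i j).

End random.

Section blocks.
Variables (R : realType) (n r : nat) (N : 'I_r -> {set 'I_n}).

Definition interval_partition : Prop :=
  [/\ forall q, N q != finset.set0,
      forall p q, p != q -> N p :&: N q = finset.set0,
      forall j, exists q, j \in N q &
      forall q (i j k : 'I_n), i \in N q -> k \in N q -> (i <= j <= k)%N -> j \in N q].

Definition block_proj (q : 'I_r) : 'M[R[i]]_n := diag_mx (\row_j (j \in N q)%:R).

Definition sym_block (p q : 'I_r) (Y : 'M[R[i]]_n) : 'M[R[i]]_n :=
  if p == q then block_proj q *m Y *m block_proj q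
  else block_proj p *m Y *m block_proj q + block_proj q *m Y *m block_proj p.

Definition block_pow (e : bool) p q Y :=
  if e then map_mx conjc (sym_block p q Y)^T else sym_block p q Y.

End blocks.

(* Main.v *)
(* The moments are determined by their loop (Schwinger-Dyson) equations.
   Gaussian integration by parts, applied to the first block T_{p,q}^e(u) of a
   product of normalized partial traces tau_b(W), pairs this block with another
   occurrence of Y(u). If that occurrence is in the same word, the word splits
   in two, with a weight tending to d_b v_{p,q}(u); if it is in another word, the
   two words merge, with a weight bounded by a multiple of 1/n. On the Fock space,
   the vacuum moments satisfy the split equation exactly: the particle which the
   last operator annihilates was created by one of the preceding ones, and the
   operators in between act as if on the vacuum. Induction on the total length
   of the words shows that the expectation of a product of partial traces tends
   to the product of the vacuum moments; the theorem is the case of one word. *)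
Require Import Defs.
From HB Require Import structures.
From mathcomp Require Import all_boot all_order all_algebra.
From mathcomp Require Import all_classical all_reals all_analysis.
From mathcomp Require Import measurable_realfun complex ring lra zify.
From mathcomp Require Import -(notations) mpoly.

Import Order.TTheory GRing.Theory Num.Theory.
Import numFieldNormedType.Exports.

Local Open Scope classical_set_scope.
Local Open Scope ring_scope.

Set Implicit Arguments.
Unset Strict Implicit.
Unset Printing Implicit Defensive.

(** * Gaussian moments *)

(** Splitting a trace leaves two traces under one expectation, so the equation for a single trace
    does not close; lists of traces do close, and the factorization of the limit comes out together
    with the limit. Some d_q may vanish, so n_q need not be of order n; the merge weight, of order
    1/(n n_q), still tends to 0 because n_q is at least 1. Gaussianity enters only through the
    recursion E X^(k+1) = k v E X^(k-1), which also covers the constant variables of variance v = 0.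
    For polynomials in independent variables it becomes integration by parts with formal partial
    derivatives. Hence the loop equation can be derived in an abstract commutative algebra with
    derivations, where no integrability question arises. The two sides have the same pairing rule.
    For a centred complex Gaussian z with independent parts of equal variance, E z^2 = 0, so only z
    and its conjugate pair; on the Fock space, a particle created by [eta] carries label 2u-1 and
    can be annihilated only by the adjoint of an [eta], and conversely with label 2u. Each pairing
    uses the amplitude sqrt(d_b v) twice, which gives the weight d_b v. *)

Section density.
Local Open Scope ereal_scope.
Import HBNNSimple.
Context d d' (T : measurableType d) (T' : measurableType d') (R : realType).
Variables (mu : {measure set T -> \bar R}) (nu : {measure set T' -> \bar R}).
Variables (X : T -> T') (G : T -> R).
Hypotheses (mX : measurable_fun [set: T] X) (mG : measurable_fun [set: T] G).
Hypothesis G0 : forall x, (0 <= G x)%R.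
Hypothesis nuE : forall A, measurable A ->
  nu A = \int[mu]_(x in X @^-1` A) (G x)%:E.

Let integral_nnsfun_density (h : {nnsfun T' >-> R}) :
  \int[nu]_y (h y)%:E = \int[mu]_x ((h (X x))%:E * (G x)%:E).
Proof.
under [LHS]eq_integral do rewrite fimfunE -fsumEFin//.
rewrite [LHS]ge0_integral_fsum//; last 2 first.
  - by move=> r; exact/measurable_EFinP/measurableT_comp.
  - by move=> n x _; rewrite EFinM nnfun_muleindic_ge0.
under [RHS]eq_integral.
  move=> x _; rewrite fimfunE -fsumEFin// ge0_mule_fsuml; last first.
    by move=> r; rewrite EFinM nnfun_muleindic_ge0.
  over.
have mind r : measurable_fun [set: T] (\1_(h @^-1` [set r]) \o X : T -> R).
  by apply: measurableT_comp.
rewrite [RHS]ge0_integral_fsum//; last 2 first.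
  - move=> r; apply: emeasurable_funM; apply/measurable_EFinP => //.
    by apply: measurable_funM => //; exact: mind.
  - by move=> n x _; rewrite EFinM mule_ge0 ?nnfun_muleindic_ge0// lee_fin.
apply: eq_fsbigr => r /[!inE] -[y _ hy].
have r0 : (0 <= r)%R by rewrite -hy.
rewrite integralZl_indic_nnsfun//= integral_indic// setIT nuE//.
under [RHS]eq_integral do rewrite EFinM -muleA.
rewrite ge0_integralZl//; first last.
  - by move=> x _; apply: mule_ge0; rewrite lee_fin.
  - by apply: emeasurable_funM; apply/measurable_EFinP => //; exact: mind.
congr (_ * _); rewrite [LHS]integral_mkcond; apply: eq_integral => x _.
rewrite patchE indicE /=; case: ifPn => xr.
  by rewrite mem_set ?mul1e//; move: xr; rewrite inE.
by rewrite memNset ?mul0e//; move: xr => /negP; rewrite inE.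
Qed.

(** Here [nu] is the image under [X] of the measure with density [G] with respect to [mu]; simple
    functions and monotone convergence extend [nuE] to functions. Three cases are used below: [G] =
    1 for the law of a variable, [X] = id for the normal density, and [G] a product of the remaining
    factors for independence. *)
Lemma ge0_integral_density (f : T' -> \bar R) :
  measurable_fun [set: T'] f -> (forall y, 0 <= f y) ->
  \int[nu]_y f y = \int[mu]_x (f (X x) * (G x)%:E).
Proof.
move=> mf f0; pose h := nnsfun_approx measurableT mf.
have hf y : (h n y)%:E @[n --> \oo] --> f y by exact: cvg_nnsfun_approx.
have ndh y : {homo (fun n => (h n y)%:E) : m n / (m <= n)%N >-> m <= n}.
  by move=> m n mn; rewrite lee_fin; exact/lefP/nd_nnsfun_approx.
transitivity (limn (fun n => \int[nu]_y (h n y)%:E)).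
  rewrite -monotone_convergence//; last 2 first.
  - by move=> n; exact/measurable_EFinP.
  - by move=> n x _; rewrite lee_fin.
  by apply: eq_integral => y _; apply/esym/cvg_lim => //; exact: hf.
under eq_fun do rewrite integral_nnsfun_density.
rewrite -monotone_convergence//; last 3 first.
- move=> n; apply: emeasurable_funM; apply/measurable_EFinP => //.
  exact: measurableT_comp.
- by move=> n x _; apply: mule_ge0; rewrite lee_fin.
- by move=> x _ m n mn; rewrite lee_wpmul2r ?lee_fin//; exact: (ndh (X x)).
apply: eq_integral => x _; apply/cvg_lim => //.
by apply: cvgeZr => //; exact: hf.
Qed.

Let measurable_density (f : T' -> R) : measurable_fun [set: T'] f ->
  measurable_fun [set: T] (fun x => f (X x) * G x)%R.
Proof. by move=> mf; apply: measurable_funM => //; exact: measurableT_comp. Qed.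

Lemma integrable_density (f : T' -> R) : measurable_fun [set: T'] f ->
  nu.-integrable [set: T'] (EFin \o f) <->
  mu.-integrable [set: T] (fun x => (f (X x) * G x)%:E).
Proof.
move=> mf; have fE : \int[nu]_y `|(f y)%:E| = \int[mu]_x `|(f (X x) * G x)%:E|.
  rewrite (ge0_integral_density (f := fun y => `|(f y)%:E|))//; last first.
    by apply: measurableT_comp => //; exact/measurable_EFinP.
  by apply: eq_integral => x _; rewrite EFinM abseM (gee0_abs (x := (G x)%:E)) ?lee_fin.
split=> /integrableP[_ foo]; apply/integrableP; split.
- exact/measurable_EFinP/measurable_density.
- by rewrite -fE.
- exact/measurable_EFinP.
- by rewrite /= fE.
Qed.

Lemma integral_density (f : T' -> R) : measurable_fun [set: T'] f ->
  \int[nu]_y (f y)%:E = \int[mu]_x (f (X x) * G x)%:E.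
Proof.
move=> mf; have mfE : measurable_fun [set: T'] (EFin \o f) by exact/measurable_EFinP.
rewrite integralE [RHS]integralE; congr (_ - _).
- rewrite (ge0_integral_density (f := (EFin \o f)^\+))//; last exact: measurable_funepos.
  by apply: eq_integral => x _; rewrite !funeposE EFinM maxe_pMl ?lee_fin//= mul0e.
- rewrite (ge0_integral_density (f := (EFin \o f)^\-))//; last exact: measurable_funeneg.
  by apply: eq_integral => x _; rewrite !funenegE EFinM -mulNe maxe_pMl ?lee_fin//= mul0e.
Qed.

End density.

Section gaussian_calculus.
Variables (R : realType) (m : R).
Implicit Types (s : R) (k : nat).

(** With z = (x - m)^2 / (8 s^2), the two Gaussian factors are e^(-4z) and e^(-z). The power is at
    most 1 + (x - m)^(2k) = 1 + (8 s^2 z)^k, hence at most (1 + (8 s^2)^k k!) e^z. This one bound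
    gives both integrability and decay at infinity. *)
Lemma normX_normal_fun_le s k : s != 0 -> exists2 C, 0 <= C &
  forall x, `|x - m| ^+ k * normal_fun m s x <= C * normal_fun m (2 * s) x.
Proof.
move=> s0; have s2 : 0 < s ^+ 2 *+ 2 by rewrite pmulrn_lgt0// exprn_even_gt0.
exists (1 + (s ^+ 2 *+ 2 * 4) ^+ k * k`!%:R).
  by rewrite addr_ge0// mulr_ge0// exprn_ge0// mulr_ge0// ltW.
move=> x; rewrite /normal_fun; set y := (x - m) ^+ 2 / (s ^+ 2 *+ 2).
have y0 : 0 <= y / 4 by rewrite !divr_ge0 ?sqr_ge0// ltW.
have -> : - (x - m) ^+ 2 / (s ^+ 2 *+ 2) = - (y / 4) * 4 by rewrite /y; field.
have -> : - (x - m) ^+ 2 / ((2 * s) ^+ 2 *+ 2) = - (y / 4) by rewrite /y; field.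
have xk : `|x - m| ^+ k <= (1 + (s ^+ 2 *+ 2 * 4) ^+ k * k`!%:R) * expR (y / 4).
  apply: (@le_trans _ _ (1 + (`|x - m| ^+ k) ^+ 2)).
    have := sqr_ge0 (`|x - m| ^+ k - 1); have := sqr_ge0 (`|x - m| ^+ k); nra.
  rewrite mulrDl mul1r lerD //; first by rewrite -[leLHS]expR0 ler_expR.
  rewrite exprAC real_normK ?num_real//.
  have -> : (x - m) ^+ 2 = (s ^+ 2 *+ 2 * 4) * (y / 4) by rewrite /y; field.
  rewrite exprMn -mulrA ler_wpM2l//; first by rewrite exprn_ge0// mulr_ge0// ltW.
  rewrite -ler_pdivrMl ?ltr0n ?fact_gt0// mulrC.
  case: k => [|k]; first by rewrite expr0 divr1 -[leLHS]expR0 ler_expR.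
  by apply: le_trans (expR_ge1Dxn k y0); rewrite lerDr.
apply: le_trans (ler_wpM2r (expR_ge0 _) xk) _.
rewrite -mulrA ler_wpM2l//.
  by rewrite addr_ge0// mulr_ge0// exprn_ge0// mulr_ge0// ltW.
by rewrite -expRD ler_expR; lra.
Qed.

Lemma integrable_expr_normal_fun s k : s != 0 ->
  (@lebesgue_measure R).-integrable [set: R]
    (fun x => ((x - m) ^+ k * normal_fun m s x)%:E).
Proof.
move=> s0; have [C C0 hC] := normX_normal_fun_le k s0.
have s20 : 2 * s != 0 by rewrite mulf_neq0.
have ip := @integrable_normal_pdf R m (2 * s).
have := integrableZl measurableT (C / normal_peak (2 * s)) ip.
apply: le_integrable => //.
  apply/measurable_EFinP; apply: measurable_funM; last exact: measurable_normal_fun.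
  by apply: measurable_funX; exact: measurable_funB.
move=> x _; rewrite /= normal_pdfE// lee_fin normrM normrX.
rewrite (ger0_norm (normal_fun_ge0 _ _ _)); apply: le_trans (hC x) _.
have p0 := normal_peak_gt0 s20.
by rewrite mulrA divfK ?gt_eqF// ger0_norm// mulr_ge0// normal_fun_ge0.
Qed.

(** The integral of this derivative over the line vanishes, which is the moment recursion. At [k] =
    0 the truncated exponent [k.-1] is multiplied by 0. *)
Lemma is_derive_expr_normal_fun s k (x : R) : s != 0 ->
  is_derive x 1 (fun y => (y - m) ^+ k * normal_fun m s y)
    (k%:R * (x - m) ^+ k.-1 * normal_fun m s x -
     (x - m) ^+ k.+1 / s ^+ 2 * normal_fun m s x).
Proof.
move=> s0.
have d1 : is_derive x 1 (fun y : R => y - m) 1.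
  by apply: is_derive_eq; rewrite subr0.
have d2 : is_derive x 1 (fun y : R => (y - m) ^+ k) (k%:R * (x - m) ^+ k.-1).
  rewrite (_ : (fun y => _) = (fun y : R => y - m) ^+ k); last by rewrite exprfctE.
  by apply: (is_derive_eq (is_deriveX k d1)); rewrite /GRing.scale/= mulr1.
have d3 : is_derive x 1 (fun y : R => - (y - m) ^+ 2 / (s ^+ 2 *+ 2)) (- (x - m) / s ^+ 2).
  rewrite (_ : (fun y => _) = - (s ^+ 2 *+ 2)^-1 \*: (fun y : R => y - m) ^+ 2).
    apply: (is_derive_eq (is_deriveZ _ (is_deriveX 2 d1))).
    by rewrite /GRing.scale/= expr1; field.
  apply/funext => y; rewrite exprfctE.
  by transitivity (- (s ^+ 2 *+ 2)^-1 * (y - m) ^+ 2 : R) => //; field.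
have d4 := is_derive1_comp (is_derive_expR _) d3.
have d5 := is_deriveM d2 d4.
apply: (is_derive_eq d5).
have alg (a b c z w : R) : w != 0 ->
    a * (c * (- z / w)) + c * (k%:R * b) = k%:R * b * c - z * a / w * c.
  by move=> w0; field.
by apply: (etrans (alg _ _ _ _ _ _)); rewrite ?expf_neq0 -?exprS.
Qed.

Local Notation mu := (@lebesgue_measure R).

(** Dominated convergence passes from compact intervals, on which the fundamental theorem of
    calculus is applied, to the whole line. *)
Lemma cvg_integral_symitv (g : R -> R) : mu.-integrable [set: R] (EFin \o g) ->
  (\int[mu]_(x in `[(- n%:R)%R, n%:R]) (g x)%:E)%E @[n --> \oo] -->
  (\int[mu]_x (g x)%:E)%E.
Proof.
move=> ig; have mg : measurable_fun [set: R] (EFin \o g) by case/integrableP: ig.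
pose gn (n : nat) x := (((EFin \o g) \_ `[(- n%:R)%R, n%:R]) x)%E.
have -> : (fun n => \int[mu]_(x in `[(- n%:R)%R, n%:R]) (g x)%:E)%E =
          (fun n => \int[mu]_x gn n x)%E.
  by apply/funext => n; rewrite integral_mkcond.
have [|||||_ _ //] := @dominated_convergence _ _ R mu [set: R] measurableT gn
  (EFin \o g) (abse \o (EFin \o g)).
- by move=> n; apply/(measurable_restrictT _ _).1 => //; exact: measurable_funTS.
- exact: mg.
- apply: aeW => x _; apply: cvg_near_cst; near=> n.
  have xn : `|x| <= n%:R by near: n; exact: nbhs_infty_ger.
  by rewrite /gn patchE mem_set//= in_itv/= -ler_norml.
- exact: integrable_abse.
- apply: aeW => x n _; rewrite /gn patchE; case: ifPn => //= _.
  by rewrite normr0 lee_fin.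
Unshelve. all: by end_near. Qed.

Lemma cvg_normal_fun_pinfty s : s != 0 -> normal_fun m s x @[x --> +oo%R] --> 0.
Proof.
move=> s0; have s2 : 0 < s ^+ 2 *+ 2 by rewrite pmulrn_lgt0// exprn_even_gt0.
have -> : normal_fun m s = (fun y => expR (- y)) \o (fun x => (x - m) ^+ 2 / (s ^+ 2 *+ 2)).
  by apply/funext => x /=; rewrite -mulNr.
suff h : (x - m) ^+ 2 / (s ^+ 2 *+ 2) @[x --> +oo%R] --> +oo%R.
  exact: cvg_comp h (@cvgr_expR R).
apply/cvgryPge => A; near=> x.
rewrite ler_pdivlMr//; apply: (@le_trans _ _ (x - m)).
  by rewrite lerBrDr; near: x; apply: nbhs_pinfty_ge; rewrite num_real.
have : 1 + m <= x by near: x; apply: nbhs_pinfty_ge; rewrite num_real.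
by rewrite -subr_ge0 expr2 => h; nra.
Unshelve. all: by end_near. Qed.

Lemma cvg_expr_normal_fun_pinfty s k : s != 0 ->
  (x - m) ^+ k * normal_fun m s x @[x --> +oo%R] --> 0.
Proof.
move=> s0; have [C C0 hC] := normX_normal_fun_le k s0.
apply/norm_cvg0P.
apply: (@squeeze_cvgr _ _ _ _ (cst 0) (fun x => C * normal_fun m (2 * s) x)).
- apply: nearW => x /=; rewrite normr_ge0/= normrM normrX.
  by rewrite (ger0_norm (normal_fun_ge0 _ _ _)) hC.
- exact: cvg_cst.
- rewrite -[0](mulr0 C); apply: cvgMr; apply: cvg_normal_fun_pinfty.
  by rewrite mulf_neq0.
Qed.

End gaussian_calculus.

Section gaussian_moments.
Variables (R : realType) (m s : R).
Hypothesis s0 : s != 0.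
Local Notation mu := (@lebesgue_measure R).

Let F k x := (x - m) ^+ k * normal_fun m s x.

Let continuous_F k : continuous (F k).
Proof.
move=> x; apply: (@differentiable_continuous R R R); apply/derivable1_diffP.
by have [] := is_derive_expr_normal_fun m k x s0.
Qed.

Let F_boundary k : F k n%:R - F k (- n%:R) @[n --> \oo] --> 0.
Proof.
rewrite -[0](subr0 0); apply: cvgB.
  exact: cvg_comp (@cvgr_idn R) (@cvg_expr_normal_fun_pinfty R m s k s0).
(* The reflection x -> -x replaces [m] by [- m] and contributes the sign (-1)^k, so the limit at -oo
   is again one at +oo. *)
have -> : (fun n => F k (- n%:R)) =
    (fun n => (-1) ^+ k * ((n%:R - - m) ^+ k * normal_fun (- m) s n%:R)).
  apply/funext => n; rewrite /F mulrA -exprMn; congr (_ ^+ k * _); first by ring.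
  have e : - n%:R - m = - (n%:R - - m) by ring.
  by rewrite /normal_fun e sqrrN.
rewrite -[0](mulr0 ((-1) ^+ k)); apply: cvgMr.
exact: cvg_comp (@cvgr_idn R) (@cvg_expr_normal_fun_pinfty R (- m) s k s0).
Qed.

Lemma integral_expr_normal_funS k :
  \int[mu]_x ((x - m) ^+ k.+1 * normal_fun m s x) =
  k%:R * s ^+ 2 * \int[mu]_x ((x - m) ^+ k.-1 * normal_fun m s x).
Proof.
have iF j : mu.-integrable setT (EFin \o F j) by exact: integrable_expr_normal_fun.
(* [g] is the derivative of [F k]; its vanishing integral is the claim. *)
pose g x := k%:R * F k.-1 x - (s ^+ 2)^-1 * F k.+1 x.
have ig : mu.-integrable setT (EFin \o g).
  exact: (integrableB measurableT (integrableZl measurableT k%:R (iF k.-1))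
    (integrableZl measurableT (s ^- 2) (iF k.+1))).
suff g0 : \int[mu]_x g x = 0.
  move: g0; rewrite /g RintegralB//; last 2 first.
  - exact: integrableZl (iF _).
  - exact: integrableZl (iF _).
  rewrite !RintegralZl// => /eqP; rewrite subr_eq0 => /eqP gE.
  by rewrite mulrAC gE mulrAC mulVf ?mul1r// expf_neq0.
(* The shift to [n.+1] keeps the interval nondegenerate. *)
have gn n : (\int[mu]_(x in `[(- n.+1%:R)%R, n.+1%:R]) (g x)%:E)%E =
    (F k n.+1%:R - F k (- n.+1%:R))%:E.
  rewrite EFinB; apply: continuous_FTC2.
  - by rewrite gtrN.
  - apply: continuous_subspaceT => x; apply: cvgB; apply: cvgMr; exact: continuous_F.
  - split.
    + by move=> x _; have [] := is_derive_expr_normal_fun m k x s0.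
    + by apply: cvg_at_right_filter; exact: continuous_F.
    + by apply: cvg_at_left_filter; exact: continuous_F.
  - move=> x _; rewrite derive1E; have h := is_derive_expr_normal_fun m k x s0.
    by rewrite derive_val /g /F; ring.
have h1 := cvg_integral_symitv ig.
have h2 : ((F k n.+1%:R - F k (- n.+1%:R))%:E : \bar R) @[n --> \oo] --> 0%E.
  by apply: cvg_EFin; [exact: nearW|have := F_boundary k; rewrite -cvg_shiftS].
move: h1; rewrite -cvg_shiftS/=; under eq_fun do rewrite gn; move=> h1.
by rewrite /Rintegral (cvg_unique _ h1 h2).
Qed.

End gaussian_moments.

Section gaussian_variable.
Context d (T : measurableType d) (R : realType) (P : probability T R).
Local Notation Rm := (measurableTypeR R).
Variables (X : T -> Rm).
Hypothesis mX : measurable_fun [set: T] X.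
Local Notation mu := (@lebesgue_measure R).

Let law (nu : {measure set Rm -> \bar R}) := forall A, measurable A -> P (X @^-1` A) = nu A.

Let lawE nu : law nu -> forall A, measurable A ->
  nu A = (\int[P]_(x in X @^-1` A) (cst 1%R x)%:E)%E.
Proof.
move=> h A mA; rewrite -h// -[LHS]mul1e -integral_cst//.
by rewrite -[X in measurable X]setTI; exact: mX.
Qed.

Let integrable_law nu : law nu -> forall f : Rm -> R, measurable_fun [set: Rm] f ->
  nu.-integrable [set: Rm] (EFin \o f) <-> P.-integrable [set: T] (EFin \o (f \o X)).
Proof.
move=> h f mf; rewrite (integrable_density mX _ _ (lawE h) mf)//.
by rewrite (_ : (fun x => _) = EFin \o (f \o X))//; apply/funext => x /=; rewrite mulr1.
Qed.

Let Rintegral_law nu : law nu -> forall f : Rm -> R, measurable_fun [set: Rm] f ->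
  \int[P]_x f (X x) = \int[nu]_y f y.
Proof.
move=> h f mf; rewrite /Rintegral (integral_density mX _ _ (lawE h) mf)//.
by congr fine; apply: eq_integral => x _; rewrite mulr1.
Qed.

Let measurable_expr_sub (m : R) k : measurable_fun [set: Rm] (fun x : Rm => (x - m : R) ^+ k).
Proof. by apply: measurable_funX; exact: measurable_funB. Qed.

Lemma normal_moments (m s : R) k : s != 0 -> law (normal_prob m s) ->
  P.-integrable [set: T] (EFin \o (fun x => (X x - m) ^+ k)) /\
  \int[P]_x (X x - m) ^+ k.+1 = k%:R * s ^+ 2 * \int[P]_x (X x - m) ^+ k.-1.
Proof.
move=> s0 h.
have dens (A : set Rm) : measurable A ->
  (normal_prob m s A = \int[mu]_(x in (@id Rm) @^-1` A) (normal_pdf m s x)%:E)%E by [].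
have mp : measurable_fun [set: Rm] (normal_pdf m s : Rm -> R).
  exact: measurable_normal_pdf.
have pE j x : (x - m) ^+ j * normal_pdf m s x = normal_peak s * ((x - m) ^+ j * normal_fun m s x).
  by rewrite normal_pdfE// mulrCA.
have ip j : mu.-integrable [set: R] (EFin \o (fun x => (x - m) ^+ j * normal_pdf m s x)).
  apply: (eq_integrable measurableT); last first.
    exact: (integrableZl measurableT (normal_peak s) (integrable_expr_normal_fun m j s0)).
  by move=> x _ /=; rewrite pE.
have momE j : \int[P]_x (X x - m) ^+ j = normal_peak s * \int[mu]_x ((x - m) ^+ j * normal_fun m s x).
  rewrite (Rintegral_law h (measurable_expr_sub m j)) /Rintegral.
  rewrite (integral_density (@measurable_id _ Rm _) mp (normal_pdf_ge0 _ _) dens)//.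
  under eq_integral do rewrite pE.
  exact: (RintegralZl _ measurableT (integrable_expr_normal_fun m j s0)).
split; last by rewrite !momE integral_expr_normal_funS// mulrCA.
apply/(integrable_law h (measurable_expr_sub m k)).
apply/(integrable_density (@measurable_id _ Rm _) mp (normal_pdf_ge0 _ _) dens
  (measurable_expr_sub m k)).
exact: ip.
Qed.

Lemma dirac_moments (m : R) k : law (@dirac _ Rm m R) ->
  P.-integrable [set: T] (EFin \o (fun x => (X x - m) ^+ k)) /\
  \int[P]_x (X x - m) ^+ k.+1 = 0.
Proof.
have mE j : measurable_fun [set: Rm] (fun x : Rm => ((x - m) ^+ j)%:E).
  by apply/measurable_EFinP; exact: measurable_expr_sub.
move=> h; split.
  apply/(integrable_law h (measurable_expr_sub m k)); apply/integrableP; split.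
    exact: mE.
  rewrite integral_dirac//; first by rewrite diracT mul1e ltry.
  by apply: measurableT_comp => //; exact: mE.
rewrite (Rintegral_law h (measurable_expr_sub m k.+1)) /Rintegral integral_dirac//.
by rewrite diracT mul1e/= subrr expr0n.
Qed.

End gaussian_variable.

(** The parameters of the law are existential in [gaussian] and have to be recovered from the first
    two moments. Both the normal and the Dirac case satisfy the recursion for the powers of [X - m],
    with some [w]; its instance k = 0 says that [X - m] has mean 0, so [m] = 0, and then k = 1
    identifies [w] with the second moment. *)
Lemma gaussian_moments d (T : measurableType d) (R : realType) (P : probability T R)
    (X : T -> R) (v : R) :
  gaussian P X -> ('E_P[X] = 0)%E -> ('E_P[fun x => (X x ^+ 2)%R] = v%:E)%E ->
  forall k, P.-integrable [set: T] (EFin \o (fun x => X x ^+ k)) /\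
    \int[P]_x X x ^+ k.+1 = k%:R * v * \int[P]_x X x ^+ k.-1.
Proof.
move=> [mX [m [s h]]] X0 X2 k.
have [v0 mom] : exists w : R, forall j,
    P.-integrable [set: T] (EFin \o (fun x => (X x - m) ^+ j)) /\
    \int[P]_x (X x - m) ^+ j.+1 = j%:R * w * \int[P]_x (X x - m) ^+ j.-1.
  have [s0|s0] := eqVneq s 0.
    exists 0 => j; have [|-> ->] := @dirac_moments _ _ _ P X mX m j.
      by move=> A mA; rewrite h// s0 eqxx.
    by rewrite mulr0 mul0r.
  exists (s ^+ 2) => j; apply: normal_moments => //.
  by move=> A mA; rewrite h// (negbTE s0).
have m0 : m = 0.
  have [i1 ] := mom 1%N; have [_] := mom 0%N; rewrite !mul0r => + _.
  have i1' : P.-integrable setT (EFin \o X).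
    apply: (eq_integrable measurableT); last first.
      exact: (integrableD measurableT i1 (finite_measure_integrable_cst P m measurableT)).
    by move=> x _ /=; rewrite expr1 -EFinD subrK.
  rewrite (_ : \int[P]_x _ = \int[P]_x (X x - m)); last first.
    by congr fine; apply: eq_integral => x _; rewrite expr1.
  rewrite RintegralB//; last exact: finite_measure_integrable_cst.
  have -> : \int[P]__ m = m.
    by rewrite Rintegral_cst//; rewrite [X in fine X](_ : _ = 1%E) ?mulr1//; exact: probability_setT.
  move: X0; rewrite unlock /Rintegral => ->.
  by rewrite sub0r => /eqP; rewrite oppr_eq0 => /eqP.
have XE j : (fun x => (X x - m) ^+ j) = (fun x => X x ^+ j).
  by apply/funext => x; rewrite m0 subr0.
suff -> : v = v0 by have := mom k; rewrite !XE.
have [_] := mom 1%N; rewrite !XE => X2E.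
have /(congr1 fine) /= <- : (\int[P]_x (X x ^+ 2)%:E)%E = v%:E by rewrite -X2 unlock.
rewrite [LHS]X2E mul1r (_ : \int[P]_x _ = \int[P]_x 1).
  rewrite Rintegral_cst// mul1r [X in fine X](_ : _ = 1%E) ?mulr1//.
  exact: probability_setT.
by congr fine; apply: eq_integral.
Qed.

(** * Independence and integration by parts *)

Section independence.
Context d (T : measurableType d) (R : realType) (P : probability T R).
Local Notation Rm := (measurableTypeR R).
Variables (I : finType) (X : I -> T -> Rm).
Hypothesis mX : forall i, measurable_fun [set: T] (X i).
Hypothesis indepX : mutually_independent P X.
Implicit Type g : I -> Rm -> R.

Let mcomp (f : Rm -> R) i : measurable_fun [set: Rm] f -> measurable_fun [set: T] (f \o X i).
Proof. by move=> mf; exact: measurableT_comp. Qed.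

Let mpre i (A : set Rm) : measurable A -> measurable (X i @^-1` A).
Proof. by move=> mA; rewrite -[_ @^-1` _]setTI; exact: mX. Qed.

Let upd g i0 (f : Rm -> R) i := if i == i0 then f else g i.

Let prod_upd g i0 f x : \prod_i upd g i0 f i (X i x) =
  f (X i0 x) * \prod_(i | i != i0) g i (X i x).
Proof.
rewrite (bigD1 i0)//= /upd eqxx; congr (_ * _).
by apply: eq_bigr => i /negbTE ->.
Qed.

(* The sequence [s] lists the factors that are not yet known to be indicators:
   the factors are changed from indicators to arbitrary functions one at a time. *)
Lemma ge0_integral_prod_indep (s : seq I) g :
  (forall i, measurable_fun [set: Rm] (g i)) -> (forall i y, 0 <= g i y) ->
  (forall i, P.-integrable [set: T] (EFin \o (g i \o X i))) ->
  (forall i, i \notin s -> exists2 A : set Rm, measurable A & g i = \1_A) ->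
  (\int[P]_x (\prod_i g i (X i x))%:E =
   (\prod_i (\int[P]_x g i (X i x)))%:E)%E.
Proof.
move: g; elim: s => [|i0 s IH] g mg g0 ig gS.
  have /choice[A hA] : forall i, exists A : set Rm, measurable A /\ g i = \1_A.
    by move=> i; have [|A mA gA] := gS i; [by []|exists A].
  have mA i : measurable (A i) by have [] := hA i.
  have gA i : g i = \1_(A i) by have [] := hA i.
  have gE x : \prod_i g i (X i x) = \1_(\bigcap_(i in [set` [set: I]%SET]) (X i @^-1` A i)) x.
    rewrite indicE; case: (boolP (x \in _)) => xA.
      rewrite big1// => i _; rewrite gA indicE mem_set//.
      by move: xA; rewrite inE => /(_ i); apply; rewrite /= finset.in_setT.
    have [i xi] : exists i, ~ A i (X i x).
      apply/existsNP => h; move/negP: xA; apply; rewrite inE => i _; exact: h.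
    by rewrite (bigD1 i)//= gA indicE memNset// mul0r.
  under eq_integral do rewrite gE.
  rewrite integral_indic//; last first.
    by apply: fin_bigcap_measurable => // i _; exact: mpre.
  rewrite setIT; apply: (etrans (indepX [set: I]%SET mA)); rewrite -prodEFin.
  rewrite (eq_bigl predT); last by move=> i; rewrite finset.in_setT.
  apply: eq_bigr => i _; rewrite /Rintegral.
  rewrite (_ : (\int[P]_x _)%E = P (X i @^-1` A i)).
    by rewrite fineK// fin_num_measure//; exact: mpre.
  have -> : (\int[P]_x (g i (X i x))%:E = \int[P]_x (\1_(X i @^-1` A i) x)%:E)%E.
    by apply: eq_integral => x _; rewrite gA.
  by rewrite integral_indic ?setIT//; exact: mpre.
pose c := \prod_(i | i != i0) \int[P]_x g i (X i x).
have c0 : 0 <= c by apply: prodr_ge0 => i _; apply: Rintegral_ge0 => x _.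
pose G x := \prod_(i | i != i0) g i (X i x).
have G0 x : 0 <= G x by exact: prodr_ge0.
have mG : measurable_fun [set: T] G.
  have -> : G = (fun x => \prod_(i <- [seq i <- index_enum I | i != i0]) g i (X i x)).
    by apply/funext => x; rewrite big_filter.
  by apply: measurable_prod => i _; exact: mcomp.
(* Replacing the factor at [i0] by an indicator brings the induction hypothesis into play: the image
   under [X i0] of the measure with density [G] is [c] times the law of [X i0]. *)
have nuE A : measurable A -> mscale (NngNum c0) (pushforward P (X i0)) A =
    (\int[P]_(x in X i0 @^-1` A) (G x)%:E)%E.
  move=> mA; have : (\int[P]_x (\prod_i upd g i0 \1_A i (X i x))%:E =
      (\prod_i \int[P]_x upd g i0 \1_A i (X i x))%:E)%E.
    apply: IH => [i|i y|i|i].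
    - by rewrite /upd; case: eqP => // _; exact: measurable_indic.
    - by rewrite /upd; case: eqP => // _.
    - rewrite /upd; case: eqP => [->|_]; last exact: ig.
      apply: eq_integrable (integrable_indic P (@mpre i0 A mA)) => // x _.
    - move=> iS; rewrite /upd; case: eqP => [_|/eqP ii0]; first by exists A.
      by apply: gS; rewrite inE negb_or ii0.
  rewrite (bigD1 i0)//= {2}/upd eqxx (eq_bigr (fun i => \int[P]_x g i (X i x))); last first.
    by move=> i /negbTE ii0; rewrite /upd ii0.
  rewrite -/c /mscale/= /pushforward => h.
  transitivity ((\int[P]_x \1_A (X i0 x))%:E * c%:E)%E.
    rewrite muleC; congr (_ * _)%E; rewrite /Rintegral.
    rewrite (_ : (\int[P]_x _)%E = P (X i0 @^-1` A)) ?fineK ?fin_num_measure//; last 2 first.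
    - exact: mpre.
    - by rewrite -[in RHS](setIT (_ @^-1` _)) -(integral_indic P measurableT (@mpre i0 A mA)).
  rewrite -EFinM -h [RHS]integral_mkcond; apply: eq_integral => x _.
  rewrite prod_upd patchE indicE; case: ifPn => xA.
    by rewrite mem_set ?mul1r//; move: xA; rewrite inE.
  by rewrite memNset ?mul0r//; move: xA => /negP; rewrite inE.
have -> : (\int[P]_x (\prod_i g i (X i x))%:E = \int[P]_x (g i0 (X i0 x) * G x)%:E)%E.
  by apply: eq_integral => x _; rewrite (bigD1 i0).
rewrite -(integral_density (mX i0) mG G0 (nuE (mX i0)) (mg i0)).
rewrite ge0_integral_mscale//=; last 2 first.
- exact/measurable_EFinP.
- by move=> y _; rewrite lee_fin.
rewrite ge0_integral_pushforward//=; last 2 first.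
- exact/measurable_EFinP.
- by move=> y _; rewrite lee_fin.
rewrite (bigD1 i0)//= -/c EFinM muleC /Rintegral fineK//.
by apply: integrable_fin_num => //; exact: ig.
Qed.

(* Here [s] lists the factors that may change sign. *)
Lemma integral_prod_indep (s : seq I) g :
  (forall i, measurable_fun [set: Rm] (g i)) ->
  (forall i, P.-integrable [set: T] (EFin \o (g i \o X i))) ->
  (forall i, i \notin s -> forall y, 0 <= g i y) ->
  P.-integrable [set: T] (fun x => (\prod_i g i (X i x))%:E) /\
  \int[P]_x (\prod_i g i (X i x)) = \prod_i \int[P]_x g i (X i x).
Proof.
move: g; elim: s => [|i0 s IH] g mg ig gs.
  have g0 i y : 0 <= g i y by exact: gs.
  have h : (\int[P]_x (\prod_i g i (X i x))%:E = (\prod_i (\int[P]_x g i (X i x)))%:E)%E.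
    apply: (@ge0_integral_prod_indep (index_enum I)) => // i.
    by rewrite mem_index_enum.
  split; last by rewrite /Rintegral h.
  apply/integrableP; split.
    by apply/measurable_EFinP; apply: measurable_prod => i _; exact: mcomp.
  under eq_integral do rewrite gee0_abs ?lee_fin ?prodr_ge0//.
  by rewrite h ltry.
(* With the positive or the negative part at [i0], one factor fewer may change sign; the claim is
   linear in this factor. *)
pose gp (y : Rm) := Num.max (g i0 y) 0; pose gn (y : Rm) := Num.max (- g i0 y) 0.
have gE y : g i0 y = gp y - gn y.
  rewrite /gp /gn; case: (leP (g i0 y) 0) => h.
    by rewrite max_l ?oppr_ge0// sub0r opprK.
  by rewrite max_r ?subr0// oppr_le0 ltW.
have mgp : measurable_fun [set: Rm] gp by exact: measurable_maxr.
have mgn : measurable_fun [set: Rm] gn.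
  by apply: measurable_maxr => //; exact: measurableT_comp.
have igp : P.-integrable [set: T] (EFin \o (gp \o X i0)).
  apply: le_integrable (ig i0) => //; first exact/measurable_EFinP/mcomp.
  move=> x _; rewrite /= lee_fin /gp.
  by case: (leP (g i0 (X i0 x)) 0) => h; rewrite ?normr0.
have ign : P.-integrable [set: T] (EFin \o (gn \o X i0)).
  apply: le_integrable (ig i0) => //; first exact/measurable_EFinP/mcomp.
  move=> x _; rewrite /= lee_fin /gn.
  by case: (leP (- g i0 (X i0 x)) 0) => h; rewrite ?normr0 ?normrN.
have hu (f : Rm -> R) : measurable_fun [set: Rm] f -> (forall y, 0 <= f y) ->
    P.-integrable [set: T] (EFin \o (f \o X i0)) ->
    P.-integrable [set: T] (fun x => (f (X i0 x) * \prod_(i | i != i0) g i (X i x))%:E) /\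
    \int[P]_x (f (X i0 x) * \prod_(i | i != i0) g i (X i x)) =
    \int[P]_x f (X i0 x) * \prod_(i | i != i0) \int[P]_x g i (X i x).
  move=> mf f0 If; have [] := IH (upd g i0 f).
  - by move=> i; rewrite /upd; case: eqP.
  - by move=> i; rewrite /upd; case: eqP => [->|].
  - move=> i iS; rewrite /upd; case: eqP => [_|/eqP ii0]; first exact: f0.
    by apply: gs; rewrite inE negb_or ii0.
  rewrite (bigD1 i0)//= {3}/upd eqxx.
  rewrite (eq_bigr (fun i => \int[P]_x g i (X i x))); last first.
    by move=> i /negbTE ii0; rewrite /upd ii0.
  move=> h <-; split; first by apply: eq_integrable h => // x _; rewrite prod_upd.
  by congr fine; apply: eq_integral => x _; rewrite prod_upd.
have max0 (a : R) : 0 <= Num.max a 0 by rewrite le_max lexx orbT.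
have [ip pE] := hu _ mgp (fun y => max0 _) igp.
have [iN nE] := hu _ mgn (fun y => max0 _) ign.
have prodE x : \prod_i g i (X i x) =
    gp (X i0 x) * \prod_(i | i != i0) g i (X i x) -
    gn (X i0 x) * \prod_(i | i != i0) g i (X i x).
  by rewrite (bigD1 i0)//= gE mulrBl.
split; first by apply: eq_integrable (integrableB measurableT ip iN) => // x _; rewrite prodE.
rewrite (_ : \int[P]_x _ = \int[P]_x (gp (X i0 x) * \prod_(i | i != i0) g i (X i x) -
    gn (X i0 x) * \prod_(i | i != i0) g i (X i x))); last first.
  by congr fine; apply: eq_integral => x _; rewrite prodE.
rewrite RintegralB// pE nE -mulrBl -RintegralB// [RHS](bigD1 i0)//=.
by congr (_ * _); congr fine; apply: eq_integral => x _; rewrite gE.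
Qed.

End independence.

(** * Linearity of the expectation of complex variables *)

Section complex_expectation.
Local Open Scope complex_scope.
Context d (T : measurableType d) (R : realType) (P : probability T R).
Implicit Types (Z : T -> R[i]) (a : R[i]).

Definition cintegrable Z :=
  P.-integrable [set: T] (EFin \o (fun x => complex.Re (Z x))) /\
  P.-integrable [set: T] (EFin \o (fun x => complex.Im (Z x))).

Lemma cexpectationE Z : cexpectation P Z =
  (\int[P]_x complex.Re (Z x)) +i* (\int[P]_x complex.Im (Z x)).
Proof. by rewrite /cexpectation unlock. Qed.

Lemma cintegrableD Z1 Z2 : cintegrable Z1 -> cintegrable Z2 ->
  cintegrable (fun x => Z1 x + Z2 x).
Proof.
move=> [r1 i1] [r2 i2]; split.
- by apply: eq_integrable (integrableD measurableT r1 r2) => // x _ /=; case: (Z1 x) (Z2 x) => [? ?] [? ?].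
- by apply: eq_integrable (integrableD measurableT i1 i2) => // x _ /=; case: (Z1 x) (Z2 x) => [? ?] [? ?].
Qed.

Lemma cexpectationD Z1 Z2 : cintegrable Z1 -> cintegrable Z2 ->
  cexpectation P (fun x => Z1 x + Z2 x) = cexpectation P Z1 + cexpectation P Z2.
Proof.
move=> [r1 i1] [r2 i2]; rewrite !cexpectationE.
apply/eqP; rewrite eq_complex/= -!RintegralD//.
apply/andP; split; apply/eqP; congr fine; apply: eq_integral => x _;
  by case: (Z1 x) (Z2 x) => [? ?] [? ?].
Qed.

Lemma cintegrableZ a Z : cintegrable Z -> cintegrable (fun x => a * Z x).
Proof.
move=> [r1 i1]; split.
- apply: eq_integrable (integrableB measurableT (integrableZl measurableT (complex.Re a) r1)
     (integrableZl measurableT (complex.Im a) i1)) => // x _ /=.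
  by rewrite -!EFinM -EFinB; case: a (Z x) => [? ?] [? ?].
- apply: eq_integrable (integrableD measurableT (integrableZl measurableT (complex.Re a) i1)
     (integrableZl measurableT (complex.Im a) r1)) => // x _ /=.
  by rewrite -!EFinM -EFinD; case: a (Z x) => [? ?] [? ?].
Qed.

Lemma cexpectationZ a Z : cintegrable Z ->
  cexpectation P (fun x => a * Z x) = a * cexpectation P Z.
Proof.
move=> [r1 i1]; rewrite !cexpectationE.
have zl (c : R) (f : T -> R) : P.-integrable setT (EFin \o f) ->
    P.-integrable setT (EFin \o (fun x => c * f x)).
  by move=> fi; exact: (integrableZl measurableT c fi).
apply/eqP; rewrite eq_complex; case: a => a b /=; rewrite -!RintegralZl//.
rewrite -RintegralB//; [|exact: zl..]; rewrite -RintegralD//; [|exact: zl..].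
apply/andP; split; apply/eqP; congr fine; apply: eq_integral => x _;
  by case: (Z x) => [? ?].
Qed.

Lemma cintegrable_sum (J : Type) (s : seq J) (Z : J -> T -> R[i]) :
  (forall j, cintegrable (Z j)) -> cintegrable (fun x => \sum_(j <- s) Z j x).
Proof.
move=> iZ; elim: s => [|j s IH].
  under eq_fun do rewrite big_nil.
  by split; exact: (finite_measure_integrable_cst P 0 measurableT).
by under eq_fun do rewrite big_cons; exact: cintegrableD.
Qed.

Lemma cintegrable_real (f : T -> R) : P.-integrable [set: T] (EFin \o f) ->
  cintegrable (fun x => (f x)%:C).
Proof. by move=> fi; split => //; exact: (finite_measure_integrable_cst P 0 measurableT). Qed.

Lemma cexpectation_real (f : T -> R) :
  cexpectation P (fun x => (f x)%:C) = (\int[P]_x f x)%:C.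
Proof. by rewrite cexpectationE/= Rintegral_cst// mul0r. Qed.

End complex_expectation.

Section gaussian_integration_by_parts.
Local Open Scope complex_scope.
Context d (T : measurableType d) (R : realType) (P : probability T R).
Variables (I : finType) (X : I -> T -> R) (w : I -> R).
Hypothesis mX : forall i, measurable_fun [set: T] (X i).
Hypothesis indepX : mutually_independent P X.
Hypothesis momX : forall i k, P.-integrable [set: T] (EFin \o (fun x => X i x ^+ k)) /\
  \int[P]_x X i x ^+ k.+1 = k%:R * w i * \int[P]_x X i x ^+ k.-1.
Local Notation poly := (mpoly #|I| R[i]).
Local Notation var i := (mpolyX R[i] (mnm1 (enum_rank i))).

(** Random variables are represented by formal polynomials, whose derivatives are algebraic;
    [enum_val] translates the numbered indeterminates back to the index type [I]. *)
Definition poly_eval (x : T) (p : poly) : R[i] :=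
  meval (fun k => (X (enum_val k) x)%:C) p.

Definition poly_expectation (p : poly) : R[i] :=
  cexpectation P (fun x => poly_eval x p).

Let poly_evalX x (m : multinom #|I|) :
  poly_eval x (mpolyX R[i] m) = (\prod_i X i x ^+ m (enum_rank i))%:C.
Proof.
rewrite /poly_eval mevalX rmorph_prod/= (reindex enum_rank)/=; last first.
  exact/onW_bij/enum_rank_bij.
by apply: eq_bigr => i _; rewrite enum_rankK rmorphXn.
Qed.

Let expectationX (m : multinom #|I|) :
  cintegrable P (fun x => poly_eval x (mpolyX R[i] m)) /\
  poly_expectation (mpolyX R[i] m) =
    (\prod_i \int[P]_x X i x ^+ m (enum_rank i))%:C.
Proof.
have [||| ip pE] := @integral_prod_indep _ _ _ P I X mX indepX (index_enum I)
  (fun i y => y ^+ m (enum_rank i)).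
- by move=> i; apply: measurable_funX.
- by move=> i; have [] := momX i (m (enum_rank i)).
- by move=> i; rewrite mem_index_enum.
have -> : (fun x => poly_eval x (mpolyX R[i] m)) =
    (fun x => (\prod_i X i x ^+ m (enum_rank i))%:C).
  by apply/funext => x; exact: poly_evalX.
split; first exact: cintegrable_real.
rewrite /poly_expectation; under eq_fun do rewrite poly_evalX.
by rewrite cexpectation_real pE.
Qed.

Let poly_evalE x p : poly_eval x p =
  \sum_(m <- msupp p) mcoeff m p * poly_eval x (mpolyX R[i] m).
Proof.
rewrite {1}(mpolyE p) /poly_eval raddf_sum/=.
by apply: eq_bigr => m _; rewrite mevalZ.
Qed.

Lemma cintegrable_poly p : cintegrable P (fun x => poly_eval x p).
Proof.
under eq_fun do rewrite poly_evalE.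
by apply: cintegrable_sum => m; apply: cintegrableZ; have [] := expectationX m.
Qed.

Lemma poly_expectationD p q :
  poly_expectation (p + q) = poly_expectation p + poly_expectation q.
Proof.
rewrite /poly_expectation -cexpectationD; [|exact: cintegrable_poly..].
by under eq_fun do rewrite /poly_eval mevalD.
Qed.

Lemma poly_expectationZ c p : poly_expectation (c *: p) = c * poly_expectation p.
Proof.
rewrite /poly_expectation -cexpectationZ; last exact: cintegrable_poly.
by under eq_fun do rewrite /poly_eval mevalZ.
Qed.

Lemma poly_expectation_is_linear : linear_for *%R poly_expectation.
Proof. by move=> c p q; rewrite poly_expectationD poly_expectationZ. Qed.

HB.instance Definition _ :=
  GRing.isLinear.Build R[i] poly R[i] *%R poly_expectation poly_expectation_is_linear.

Lemma poly_expectation1 : poly_expectation 1 = 1.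
Proof.
rewrite /poly_expectation; under eq_fun do rewrite /poly_eval meval1.
rewrite (_ : (fun _ => 1) = (fun=> 1%:C)) ?cexpectation_real ?Rintegral_cst// mul1r.
by rewrite [X in fine X](_ : _ = 1%E)//; exact: probability_setT.
Qed.

(** By linearity [p] may be a monomial. Independence factors both expectations into moments; the
    factors other than [i] agree, and at [i] the identity is the moment recursion. *)
Lemma gaussian_integration_by_parts i p :
  poly_expectation (var i * p) = (w i)%:C * poly_expectation (mderiv (enum_rank i) p).
Proof.
have -> : mderiv (enum_rank i) p =
    \sum_(m <- msupp p) mcoeff m p *: mderiv (enum_rank i) (mpolyX R[i] m).
  by rewrite {1}(mpolyE p) (big_morph _ (@mderivD _ _ _) (@mderiv0 _ _ _)); apply: eq_bigr => m _; rewrite mderivZ.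
rewrite [in LHS](mpolyE p) mulr_sumr !linear_sum mulr_sumr; apply: eq_bigr => m _.
rewrite -scalerAr !linearZ [RHS]mulrCA; congr (_ * _).
rewrite -mpolyXD mderivX linearZ/= (expectationX _).2 (expectationX _).2.
rewrite -(rmorph_nat (real_complex R)) -!rmorphM/=; congr (_%:C).
rewrite (bigD1 i)//= [in RHS](bigD1 i)//=.
rewrite mnmDE mnm1E eqxx (momX _ _).2 mnmBE mnm1E eqxx subn1 -!mulrA.
rewrite [in RHS]mulrCA; congr (_ * (_ * (_ * _))).
apply: eq_bigr => j ji.
by rewrite mnmDE mnmBE !mnm1E (inj_eq enum_rank_inj) eq_sym (negbTE ji) subn0.
Qed.

End gaussian_integration_by_parts.

(** * Loop equations *)

(* The entry (i, j) of T_{p,q} is [mask p q a b] times that of Y, for i in N_a and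
   j in N_b. *)
Definition mask r (p q a b : 'I_r) : bool :=
  (a == p) && (b == q) || (a == q) && (b == p).

(* The letter [inl a] stands for the projection D_a, and [inr (u, e, p, q)] for the
   block T_{p,q}(u), or its adjoint if [e]. Merging two words produces projections. *)
Definition letter r t := ('I_r + 'I_t * bool * 'I_r * 'I_r)%type.

(** The entry (i, j) of Y(u) pairs only with its conjugate, which is the entry (j, i) of the
    adjoint. Hence the exponent must differ from [e], and the row colour [b] and column colour [a]
    are those of the first block in reverse order. *)
Definition pairs_head r t (u : 'I_t) (e : bool) (b a : 'I_r) (W : seq (letter r t)) : bool :=
  if W is inr (u', e', p, q) :: _ then [&& u' == u, e' != e & mask p q b a] else false.

Lemma mask_sym r (p q a b : 'I_r) : mask p q a b = mask p q b a.
Proof. by rewrite /mask orbC (andbC (b == p)) (andbC (b == q)). Qed.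

(* [E] is evaluated on a list of pairs (c, W), each standing for the partial trace
   tau_c(W). *)
Definition loop_split (K : fieldType) r t (E : seq ('I_r * seq (letter r t)) -> K)
    u e b c W l : K :=
  \sum_(0 <= k < size W) (pairs_head u e b c (drop k W))%:R *
    E ((b, take k W) :: (c, drop k.+1 W) :: l).

(** The trace of [V] is cut open at its k-th letter and read cyclically from there, so the partial
    trace over colour [c'] survives as a projection in the interior; the projection on [b] joins the
    result to [W]. Of the two normalizations one remains for the merged trace, the other is the
    factor in front. The list [x] holds at most one pair and stands for an optional factor. *)
Definition loop_merge (K : fieldType) r t (E : seq ('I_r * seq (letter r t)) -> K)
    (nn : 'I_r -> K) u e b c W (x l : seq ('I_r * seq (letter r t))) : K :=
  if x is (c', V) :: _ then (nn c')^-1 *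
    \sum_(0 <= k < size V) (pairs_head u e b c (drop k V))%:R *
      E ((c, (drop k.+1 V ++ inl c' :: take k V) ++ inl b :: W) :: l)
  else 0.

Section loop_equation.
(* [A] is the algebra of polynomials in the matrix entries, [L] the expectation and
   [D e u i j] the derivation dual to the entry [y e u i j], as [LD] asserts. *)
Variables (K : fieldType) (A : comAlgType K) (L : {linear A -> K | *%R}).
Variables (n r t : nat) (cl : 'I_n -> 'I_r).
Variables (y : bool -> 'I_t -> 'I_n -> 'I_n -> A).
Variables (D : bool -> 'I_t -> 'I_n -> 'I_n -> {linear A -> A}).
Variable sigma : 'I_t -> 'I_r -> 'I_r -> K.
Hypothesis DM : forall e u i j f g, D e u i j (f * g) = D e u i j f * g + f * D e u i j g.
Hypothesis Dy : forall e u i j e' u' k l, D e u i j (y e' u' k l) =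
  [&& u' == u, e' != e, k == j & l == i]%:R *: (sigma u (cl i) (cl j))%:A.
Hypothesis LD : forall e u i j f, L (y e u i j * f) = L (D e u i j f).
Local Notation letter := (letter r t).
Local Notation word_type := (seq letter).

Definition letter_mx (l : letter) : 'M[A]_n :=
  match l with
  | inl a => \matrix_(i, j) ((i == j) && (cl i == a))%:R
  | inr (u, e, p, q) => \matrix_(i, j) ((mask p q (cl i) (cl j))%:R *: y e u i j)
  end.

Definition word_mx (W : word_type) : 'M[A]_n :=
  foldr (fun l M => letter_mx l *m M) 1%:M W.

Lemma word_mx_cat W1 W2 : word_mx (W1 ++ W2) = word_mx W1 *m word_mx W2.
Proof. by elim: W1 => [|l W1 IH] /=; rewrite ?mul1mx// IH mulmxA. Qed.

Let D1 e u i j : D e u i j 1 = 0.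
Proof.
have := DM e u i j 1 1; rewrite !mulr1 mul1r => /eqP.
by rewrite -subr_eq0 opprD addrA subrr sub0r oppr_eq0 => /eqP.
Qed.

Let Dnat e u i j k : D e u i j k%:R = 0.
Proof. by rewrite linearMn D1 mul0rn. Qed.

Lemma D_letter e u i j l a b : D e u i j (letter_mx l a b) =
  ((pairs_head u e (cl j) (cl i) [:: l])%:R * (a == j)%:R * (b == i)%:R
    * sigma u (cl i) (cl j))%:A.
Proof.
case: l => [c|[[[u' e'] p] q]]; rewrite mxE.
  by rewrite Dnat !mul0r scale0r.
rewrite linearZ/= Dy !scalerA -!natrM !mulnb mulrA -natrM mulnb /=.
congr ((_%:R * _)%:A); case: (eqVneq a j) => [->|_]; case: (eqVneq b i) => [->|_];
  by rewrite ?(andbT, andbF)// andbC -andbA.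
Qed.

(** Leibniz rule: the derivative of a paired letter is a multiple of the matrix unit at (j, i), so
    the product breaks there into two entries. *)
Lemma D_word e u i j W a b : D e u i j (word_mx W a b) =
  \sum_(0 <= k < size W)
    ((pairs_head u e (cl j) (cl i) (drop k W))%:R * sigma u (cl i) (cl j)) *:
      (word_mx (take k W) a j * word_mx (drop k.+1 W) i b).
Proof.
elim: W a b => [|l W IH] a b.
  by rewrite big_nil !mxE Dnat.
rewrite -[word_mx (l :: W)]/(letter_mx l *m word_mx W) mxE linear_sum.
rewrite -[size (l :: W)]/(size W).+1 big_nat_recl//.
rewrite (eq_bigr _ (fun h _ => DM _ _ _ _ (letter_mx l a h) (word_mx W h b))).
rewrite big_split [LHS]/=; congr (_ + _).
  rewrite drop0 -[word_mx (take 0 _)]/(1%:M) (_ : drop 1 (l :: W) = W); last by rewrite /= drop0.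
  rewrite (bigD1 i)//= big1 ?addr0; last first.
    by move=> h hi; rewrite D_letter (negbTE hi) !(mulr0, mul0r) scale0r mul0r.
  rewrite D_letter eqxx mulr1 mxE -scalerAl mul1r; case: eqVneq => _; rewrite ?mulr1 ?mul1r//.
  by rewrite !(mulr0, mul0r) scale0r scaler0.
under eq_bigr do rewrite IH mulr_sumr.
rewrite exchange_big; apply: eq_bigr => k _.
under eq_bigr do rewrite -scalerAr mulrA.
rewrite -scaler_sumr -mulr_suml.
by rewrite -[word_mx (take k.+1 _)]/(letter_mx l *m word_mx (take k W)) mxE.
Qed.

Let nn (c : 'I_r) : K := #|[pred i | cl i == c]|%:R.
Hypothesis nn0 : forall c, nn c != 0.

Definition ntrace (x : 'I_r * word_type) : A :=
  (nn x.1)^-1 *: \sum_(i | cl i == x.1) word_mx x.2 i i.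

Definition ntraces (l : seq ('I_r * word_type)) : A := \prod_(x <- l) ntrace x.

Lemma ntraces_cons x l : ntraces (x :: l) = ntrace x * ntraces l.
Proof. by rewrite /ntraces big_cons. Qed.

Lemma ntraces_nil c l : ntraces ((c, [::]) :: l) = ntraces l.
Proof.
rewrite ntraces_cons /ntrace/= (eq_bigr (fun=> 1)); last by move=> i _; rewrite mxE eqxx.
by rewrite sumr_const -[X in _ *: X]scaler_nat scalerA mulVf// scale1r mul1r.
Qed.

Lemma ntraces_proj c a W l : ntraces ((c, inl a :: W) :: l) =
  (a == c)%:R *: ntraces ((c, W) :: l).
Proof.
rewrite !ntraces_cons scalerAl; congr (_ * _).
rewrite /ntrace scalerA (mulrC (a == c)%:R) -scalerA [in RHS]scaler_sumr; congr (_ *: _).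
apply: eq_bigr => i /eqP ic.
rewrite -[word_mx _]/(letter_mx (inl a) *m word_mx W) mxE (bigD1 i)//= big1 ?addr0.
  by rewrite mxE eqxx ic/= eq_sym scaler_nat mulr_natl.
by move=> j ji; rewrite mxE eq_sym (negbTE ji) mul0r.
Qed.

(** In a trace, the two pieces left by [D_word] are still joined at the diagonal index h of colour
    [c]; summing over h multiplies them in the opposite order, with the projection on [c] in
    between. *)
Lemma D_ntrace e u i j c V : D e u i j (ntrace (c, V)) =
  \sum_(0 <= k < size V)
    ((pairs_head u e (cl j) (cl i) (drop k V))%:R * (sigma u (cl i) (cl j) / nn c)) *:
      word_mx (drop k.+1 V ++ inl c :: take k V) i j.
Proof.
rewrite linearZ linear_sum [LHS]/=.
rewrite (eq_bigr _ (fun h _ => D_word _ _ _ _ _ _ _)) exchange_big [LHS]/= scaler_sumr.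
apply: eq_bigr => k _ /=; rewrite -scaler_sumr scalerA mulrCA [X in X *: _]mulrA.
rewrite mulrAC -mulrA; congr (_ *: _).
rewrite word_mx_cat -[word_mx (inl c :: _)]/(letter_mx (inl c) *m word_mx (take k V)) mxE.
rewrite [LHS]big_mkcond; apply: eq_bigr => h _.
rewrite (_ : (_ *m word_mx (take k V)) h j = (cl h == c)%:R * word_mx (take k V) h j).
  by case: ifP => _; rewrite ?mul1r ?mul0r ?mulr0// mulrC.
rewrite mxE.
rewrite (bigD1 h)//= [X in _ + X]big1 ?addr0.
  by rewrite mxE eqxx.
by move=> g gh; rewrite mxE eq_sym (negbTE gh) mul0r.
Qed.

(** Leibniz rule for a product; [take 1 (drop k l)] selects the k-th factor without a default
    element. *)
Lemma D_ntraces e u i j l : D e u i j (ntraces l) =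
  \sum_(0 <= k < size l)
     D e u i j (ntraces (take 1 (drop k l))) * ntraces (take k l ++ drop k.+1 l).
Proof.
elim: l => [|x l IH]; first by rewrite /ntraces !big_nil D1.
rewrite ntraces_cons DM -[size (x :: l)]/(size l).+1 big_nat_recl//.
congr (_ + _).
  by rewrite /= !take0 drop0 [in RHS]/ntraces big_seq1.
rewrite IH mulr_sumr; apply: eq_bigr => k _.
by rewrite -[take k.+1 _ ++ _]/(x :: (take k l ++ drop k.+1 l)) ntraces_cons mulrCA.
Qed.

Lemma word_mx_insert_proj V c W i h :
  word_mx (V ++ inl c :: W) i h = \sum_(j | cl j == c) word_mx V i j * word_mx W j h.
Proof.
rewrite word_mx_cat -[word_mx (inl c :: _)]/(letter_mx (inl c) *m word_mx W) mxE.
rewrite [RHS]big_mkcond; apply: eq_bigr => j _.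
rewrite mxE (bigD1 j)//= big1 ?addr0.
  by rewrite mxE eqxx/=; case: ifP => _; rewrite ?mul1r ?mul0r ?mulr0.
by move=> g gj; rewrite mxE eq_sym (negbTE gj) mul0r.
Qed.

Let E (l : seq ('I_r * word_type)) : K := L (ntraces l).

Let sum_by_color c (F : 'I_n -> 'I_n -> K) :
  \sum_(i | cl i == c) \sum_j F i j =
  \sum_b \sum_(i | cl i == c) \sum_(j | cl j == b) F i j.
Proof.
rewrite [RHS]exchange_big/=; apply: eq_bigr => i _.
by rewrite (partition_big cl predT).
Qed.

(** The pieces of the cut word carry the diagonal indices j and i separately, so the double sum is a
    product of two traces. The prefactor normalizes the trace over i only; normalizing the one over
    j costs the factor [nn b]. *)
Let loop_split_step u e b c W l :
  (nn c)^-1 * \sum_(i | cl i == c) \sum_(j | cl j == b)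
    L (D e u i j (word_mx W j i) * ntraces l) =
  sigma u c b * nn b * loop_split E u e b c W l.
Proof.
rewrite /loop_split /E mulr_sumr.
transitivity ((nn c)^-1 * \sum_(i | cl i == c) \sum_(j | cl j == b) \sum_(0 <= k < size W)
  (pairs_head u e b c (drop k W))%:R * sigma u c b *
    L (word_mx (take k W) j j * word_mx (drop k.+1 W) i i * ntraces l)).
  congr (_ * _); apply: eq_bigr => i /eqP ic; apply: eq_bigr => j /eqP jb.
  rewrite D_word mulr_suml linear_sum; apply: eq_bigr => k _.
  by rewrite -scalerAl linearZ ic jb.
under eq_bigr do rewrite exchange_big/=.
rewrite exchange_big/= mulr_sumr; apply: eq_bigr => k _.
under eq_bigr do rewrite -mulr_sumr.
rewrite -mulr_sumr mulrCA.
suff -> : (nn c)^-1 * \sum_(i | cl i == c) \sum_(j | cl j == b)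
    L (word_mx (take k W) j j * word_mx (drop k.+1 W) i i * ntraces l) =
    nn b * L (ntraces ((b, take k W) :: (c, drop k.+1 W) :: l)).
  by move: (pairs_head _ _ _ _ _)%:R (sigma _ _ _) (nn b) (L _) => x1 x2 x3 x4; ring.
rewrite !ntraces_cons /ntrace -scalerAl linearZ -scalerAl -scalerAr linearZ/=.
rewrite mulrA mulfV// mul1r; congr (_ * _).
rewrite mulr_suml linear_sum exchange_big; apply: eq_bigr => j _.
rewrite mulr_suml mulr_sumr linear_sum; apply: eq_bigr => i _.
by rewrite mulrA.
Qed.

(** The opened word has the entry (i, j) and [W] the entry (j, i), so the double sum closes up to a
    single trace and no factor [nn b] arises. *)
Let loop_merge_step u e b c W x l :
  (nn c)^-1 * \sum_(i | cl i == c) \sum_(j | cl j == b)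
    L (word_mx W j i * (D e u i j (ntraces (take 1 x)) * ntraces l)) =
  sigma u c b * loop_merge E nn u e b c W (take 1 x) l.
Proof.
case: x => [|[c' V] x].
  rewrite /loop_merge mulr0 big1 ?mulr0// => i _; apply: big1 => j _.
  by rewrite /ntraces big_nil D1 mul0r mulr0 linear0.
rewrite -[take 1 _]/((c', V) :: take 0 x) take0 /loop_merge /E.
transitivity ((nn c)^-1 * \sum_(i | cl i == c) \sum_(j | cl j == b) \sum_(0 <= k < size V)
  ((pairs_head u e b c (drop k V))%:R * (sigma u c b / nn c')) *
    L (word_mx (drop k.+1 V ++ inl c' :: take k V) i j * word_mx W j i * ntraces l)).
  congr (_ * _); apply: eq_bigr => i /eqP ic; apply: eq_bigr => j /eqP jb.
  rewrite [ntraces [:: _]]/ntraces big_seq1 D_ntrace mulr_suml mulr_sumr linear_sum.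
  apply: eq_bigr => k _.
  by rewrite -scalerAl -scalerAr linearZ/= ic jb; congr (_ * L _); rewrite mulrA [word_mx W j i * _]mulrC.
under eq_bigr do rewrite exchange_big/=.
rewrite exchange_big/= !mulr_sumr; apply: eq_bigr => k _.
under eq_bigr do rewrite -mulr_sumr.
rewrite -mulr_sumr ntraces_cons /ntrace -scalerAl linearZ/= mulr_suml linear_sum/=.
rewrite [in RHS](eq_bigr (fun i => \sum_(j | cl j == b)
  L (word_mx (drop k.+1 V ++ inl c' :: take k V) i j * word_mx W j i * ntraces l))).
  move: (pairs_head _ _ _ _ _)%:R (sigma _ _ _) (nn c)^-1 (nn c')^-1 (\sum_(i | _) _).
  by move=> x1 x2 x3 x4 x5; ring.
by move=> i _; rewrite word_mx_insert_proj mulr_suml linear_sum.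
Qed.

(** The first block contributes entries [y e u i j], which [LD] trades for a derivation; its action
    on [W] splits and its action on [l] merges. Grouping the column index j by its colour b makes
    the mask and the variance constant in each group. *)
Theorem loop_equation u e p q c W l :
  E ((c, inr (u, e, p, q) :: W) :: l) =
  \sum_b (mask p q c b)%:R * sigma u c b * (nn b * loop_split E u e b c W l +
    \sum_(0 <= k < size l) loop_merge E nn u e b c W (take 1 (drop k l)) (take k l ++ drop k.+1 l)).
Proof.
rewrite [LHS]/E ntraces_cons /ntrace -scalerAl linearZ/= mulr_suml linear_sum/=.
transitivity ((nn c)^-1 * \sum_(i | cl i == c) \sum_j (mask p q c (cl j))%:R *
   ((L (D e u i j (word_mx W j i) * ntraces l) : K) +
    (L (word_mx W j i * D e u i j (ntraces l)) : K))).
  congr (_ * _); apply: eq_bigr => i /eqP ic.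
  rewrite mxE mulr_suml linear_sum.
  apply: eq_bigr => j _.
  by rewrite mxE -!scalerAl linearZ -mulrA LD DM linearD ic.
rewrite sum_by_color mulr_sumr; apply: eq_bigr => b _.
transitivity ((mask p q c b)%:R * ((nn c)^-1 * \sum_(i | cl i == c) \sum_(j | cl j == b)
   ((L (D e u i j (word_mx W j i) * ntraces l) : K) +
    (L (word_mx W j i * D e u i j (ntraces l)) : K)))).
  rewrite mulrCA; congr (_ * _); rewrite mulr_sumr; apply: eq_bigr => i _.
  by rewrite mulr_sumr; apply: eq_bigr => j /eqP ->.
rewrite -mulrA; congr (_ * _).
rewrite (eq_bigr _ (fun i _ => big_split _ _ _ _ _))/=.
rewrite big_split/= mulrDr loop_split_step mulrDr mulrA; congr (_ + _).
rewrite [RHS]mulr_sumr; under [RHS]eq_bigr do rewrite -loop_merge_step.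
rewrite -mulr_sumr.
congr (_ * _); rewrite [RHS]exchange_big/=; apply: eq_bigr => i _.
rewrite [RHS]exchange_big/=; apply: eq_bigr => j _.
by rewrite D_ntraces mulr_sumr linear_sum.
Qed.

End loop_equation.

(** * Vacuum moments on the Fock space *)

Section ell2_dot.
Local Open Scope complex_scope.
Variables (R : realType) (I : choiceType).
Local Notation C := R[i].
Implicit Types (f g : I -> R) (F G : I -> C) (x y z : ell2 R I).

Let rsummable f := summable [set: I] (EFin \o f).

Lemma rsumB f g : rsummable f -> rsummable g -> (forall w, 0 <= f w) -> (forall w, 0 <= g w) ->
  rsum (fun w => f w - g w) =
  fine (\esum_(w in [set: I]) (f w)%:E) - fine (\esum_(w in [set: I]) (g w)%:E).
Proof.
move=> sf sg f0 g0.
have := esumB sf sg (fun w _ => f0 w) (fun w _ => g0 w).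
have sum_fin h : rsummable h -> (forall w, 0 <= h w) -> (\esum_(w in [set: I]) (h w)%:E)%E \is a fin_num.
  move=> sh h0; rewrite ge0_fin_numE; last by apply: esum_ge0 => w _; rewrite lee_fin.
  by apply: le_lt_trans sh; apply: le_esum => w _; rewrite /= lee_fin ler_norm.
move=> e; rewrite -fineB ?sum_fin// -[in RHS]e fineB.
- congr (fine _ - fine _); apply: eq_esum => w _.
  + by rewrite funeposE /funrpos /= EFin_max.
  + by rewrite funenegE /funrneg /= EFin_max.
- have := summable_funepos (summableB sf sg); rewrite summableE.
  by rewrite (eq_esum (b := ((EFin \o f) \- (EFin \o g))^\+)%E)// => w _; rewrite gee0_abs.
- have := summable_funeneg (summableB sf sg); rewrite summableE.
  by rewrite (eq_esum (b := ((EFin \o f) \- (EFin \o g))^\-)%E)// => w _; rewrite gee0_abs.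
Qed.

(** The positive part of a sum is not the sum of the positive parts. By [rsumB], however, [rsum] may
    be computed from any difference of nonnegative summable families, here the sums of the positive
    and of the negative parts. *)
Lemma rsumD f g : rsummable f -> rsummable g ->
  rsum (fun w => f w + g w) = rsum f + rsum g.
Proof.
move=> sf sg.
have sp h : rsummable h -> rsummable h^\+.
  by move=> sh; apply: le_lt_trans sh; apply: le_esum => w _;
    rewrite /= lee_fin ger0_norm// /funrpos ge_max ler_norm normr_ge0.
have sn h : rsummable h -> rsummable h^\-.
  by move=> sh; apply: le_lt_trans sh; apply: le_esum => w _;
    rewrite /= lee_fin ger0_norm// /funrneg ge_max -normrN ler_norm normr_ge0.
have sD h k : rsummable h -> rsummable k -> rsummable (fun w => h w + k w).
  by move=> sh sk; exact: (summableD sh sk).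
rewrite (_ : rsum _ = rsum (fun w => (f^\+ w + g^\+ w) - (f^\- w + g^\- w))); last first.
  congr rsum; apply/funext => w.
  by have := congr1 (@^~ w) (funrposBneg f); have := congr1 (@^~ w) (funrposBneg g); rewrite /= !fctE => <- <-; lra.
rewrite rsumB; last 4 first.
- by apply: sD; exact: sp.
- by apply: sD; exact: sn.
- by move=> w; rewrite addr_ge0.
- by move=> w; rewrite addr_ge0.
have fin h : rsummable h -> (forall w, 0 <= h w) -> (\esum_(w in [set: I]) (h w)%:E)%E \is a fin_num.
  move=> sh h0; rewrite ge0_fin_numE; last by apply: esum_ge0 => w _; rewrite lee_fin.
  by apply: le_lt_trans sh; apply: le_esum => w _; rewrite /= lee_fin ler_norm.
under eq_esum do rewrite EFinD.
rewrite esumD//; [|by move=> w _; rewrite lee_fin..].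
under [in X in _ - fine X]eq_esum do rewrite EFinD.
rewrite esumD//; [|by move=> w _; rewrite lee_fin..].
have fE h : rsummable h -> (\esum_(w in [set: I]) (h^\+ w)%:E)%E \is a fin_num.
  by move=> sh; apply: fin => //; exact: sp.
have nE h : rsummable h -> (\esum_(w in [set: I]) (h^\- w)%:E)%E \is a fin_num.
  by move=> sh; apply: fin => //; exact: sn.
by rewrite fineD ?fE// fineD ?nE// /rsum opprD addrACA.
Qed.

Lemma rsumN f : rsum (fun w => - f w) = - rsum f.
Proof.
rewrite /rsum opprB; congr (fine _ - fine _).
by apply: eq_esum => w _; rewrite /funrneg /= opprK.
Qed.

Lemma rsum_image (J : choiceType) (h : J -> I) f : injective h ->
  (forall w, ~ range h w -> f w = 0) -> rsum f = rsum (f \o h).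
Proof.
move=> hinj f0; have sumE (g : I -> \bar R) : (forall w, ~ range h w -> g w = 0%E) ->
    (\esum_(w in [set: I]) g w = \esum_(w in [set: J]) g (h w))%E.
  move=> g0; rewrite -(esum_image setT h g); last by move=> ? ? _ _ /hinj.
  rewrite [RHS]esum_mkcond; apply: eq_esum => w _.
  by case: ifPn => // wh; rewrite g0// => hw; move/negP: wh; apply; rewrite inE.
rewrite /rsum !sumE// => w /f0; rewrite /funrpos /funrneg => ->.
- by rewrite ?oppr0 maxxx.
- by rewrite ?oppr0 maxxx.
Qed.

Lemma csum_image (J : choiceType) (h : J -> I) F : injective h ->
  (forall w, ~ range h w -> F w = 0) -> csum F = csum (F \o h).
Proof. by move=> hinj F0; congr (_ +i* _); apply: rsum_image => // w /F0 ->. Qed.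

Lemma csum1 F w : (forall w', w' != w -> F w' = 0) -> csum F = F w.
Proof.
move=> F0; rewrite (csum_image (J := unit) (h := fun=> w)); first last.
- by move=> w' h; apply: F0; apply/eqP => e; apply: h; exists tt.
- by move=> [] [].
have rsum_unit (f : unit -> R) : rsum f = f tt.
  rewrite /rsum (_ : [set: unit] = [set tt]); last by apply/seteqP; split => -[].
  rewrite !esum_set1 ?lee_fin// /=.
  by have := congr1 (@^~ tt) (funrposBneg f).
by rewrite /csum !rsum_unit/=; case: (F w).
Qed.

Let csummable F := rsummable (fun w => complex.Re (F w)) /\ rsummable (fun w => complex.Im (F w)).

Let csumD F G : csummable F -> csummable G ->
  csum (fun w => F w + G w) = csum F + csum G.
Proof.
move=> [rF iF] [rG iG]; apply/eqP; rewrite eq_complex/= -!rsumD//.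
by apply/andP; split; apply/eqP; congr rsum; apply/funext => w; case: (F w) (G w) => [? ?] [? ?].
Qed.

Let csummable_dot x y : csummable (fun w => x w * conjc (y w)).
Proof.
have [/asboolP sx /asboolP sy] := (ell2_valP x, ell2_valP y).
(* This family dominates the real and imaginary parts of the products, by 2|ac| <= a^2 + c^2 for
   each pair of coordinates. *)
have s : (\esum_(w in [set: I]) (sqnormc (x w) + sqnormc (y w))%:E < +oo)%E.
  under eq_esum do rewrite EFinD.
  rewrite esumD; [exact: lte_add_pinfty| |];
    by move=> w _; rewrite lee_fin sqnormc_ge0.
split; apply: le_lt_trans s; apply: le_esum => w _; rewrite /= lee_fin /sqnormc;
  case: (x w) (y w) => [a b] [c e] /=; rewrite ler_norml;
  have := sqr_ge0 (a - c); have := sqr_ge0 (a + c); have := sqr_ge0 (b - e);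
  have := sqr_ge0 (b + e); have := sqr_ge0 (a - e); have := sqr_ge0 (a + e);
  have := sqr_ge0 (b - c); have := sqr_ge0 (b + c);
  by move=> *; apply/andP; split; nra.
Qed.

Lemma dotDl x y z : dot (x + y) z = dot x z + dot y z.
Proof.
by rewrite /dot -csumD//; congr csum; apply/funext => w; rewrite -mulrDl.
Qed.

Lemma dotC x y : dot x y = conjc (dot y x).
Proof.
apply/eqP; rewrite eq_complex/= -rsumN; apply/andP; split; apply/eqP;
  congr rsum; apply/funext => w; case: (x w) (y w) => [a b] [c e] /=; ring.
Qed.

Lemma dotDr x y z : dot x (y + z) = dot x y + dot x z.
Proof. by rewrite dotC dotDl (dotC x y) (dotC x z) rmorphD. Qed.

Lemma dot_ketr x w : dot x (ket R w) = x w.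
Proof.
rewrite /dot (csum1 (w := w)) /= ?eqxx ?conjc1 ?mulr1// => w' /negbTE ->.
by rewrite conjc0 mulr0.
Qed.

Lemma dot_ketl x w : dot (ket R w) x = conjc (x w).
Proof. by rewrite dotC dot_ketr. Qed.

Implicit Types (A B : ell2 R I -> ell2 R I).

Lemma is_adjoint_sym A B : is_adjoint A B -> is_adjoint B A.
Proof. by move=> AB x y; rewrite dotC -AB -dotC. Qed.

Lemma is_adjointD A1 A2 B1 B2 : is_adjoint A1 B1 -> is_adjoint A2 B2 ->
  is_adjoint (fun x => A1 x + A2 x) (fun x => B1 x + B2 x).
Proof. by move=> h1 h2 x y; rewrite dotDl dotDr h1 h2. Qed.

(** The coefficients of a vector are its products with the kets, so an adjoint is unique and the
    value chosen by [xget] is any explicitly given one. *)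
Lemma adjointE A B : is_adjoint A B -> adjoint A = B.
Proof.
move=> AB; have: is_adjoint A (adjoint A) by exact: (@xgetPex _ (fun=> 0) [set C | is_adjoint A C] (ex_intro _ B AB)).
move=> AC; apply/funext => x; apply/val_inj/funext => w /=.
have := AC (ket R w) x; rewrite AB !dot_ketl => /(congr1 (@conjc R)).
by rewrite !conjcK.
Qed.

End ell2_dot.

(** * Annihilation operators as explicit adjoints *)

Section annihilation.
Local Open Scope complex_scope.
Variables (R : realType) (r k : nat).
Local Notation C := R[i].
Local Notation fock := (fock R r k).
Implicit Types (b : 'I_r -> 'I_r -> 'I_k -> R) (f : fock).

Lemma prepend_inj (p : 'I_r) (u : 'I_k) : injective (prepend p u).
Proof. by move=> [s1 q1] [s2 q2] [-> ->]. Qed.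

Definition annihilation_fun (b : R) (p q : 'I_r) (u : 'I_k) f (w : fock_basis r k) : C :=
  if head_index w == q then (Num.sqrt b)%:C * f (prepend p u w) else 0.

Lemma annihilation_subproof (b : R) p q u f :
  annihilation_fun b p q u f \in @square_summable R (fock_basis r k).
Proof.
apply: (@square_summable_le _ _ (sqnormc (Num.sqrt b)%:C) f);
  [exact: sqnormc_ge0| |exact: ell2_valP].
set c := sqnormc _; have c0 : 0 <= c by exact: sqnormc_ge0.
apply: (@le_trans _ _ (\esum_(w in [set: fock_basis r k])
    (c * sqnormc (f (prepend p u w)))%:E)%E).
  apply: le_esum => w _; rewrite lee_fin /annihilation_fun.
  case: ifP => _; first by rewrite sqnormcM.
  by rewrite {1}/sqnormc /= expr0n addr0 mulr_ge0 ?sqnormc_ge0.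
apply: (le_trans (esumZ_le _ c0)); rewrite lee_wpmul2l ?lee_fin//.
rewrite -(esum_image setT (prepend p u) (fun w => (sqnormc (f w))%:E)); last first.
  by move=> ? ? _ _ /prepend_inj.
rewrite esum_mkcond; apply: le_esum => w _.
by case: ifP => _; rewrite ?lee_fin ?sqnormc_ge0.
Qed.

Definition annihilation b p q u f : fock :=
  Ell2 (annihilation_subproof (b p q u) p q u f).

Let conjc_scale (a : R) (z : C) : conjc (a%:C * z) = a%:C * conjc z.
Proof. by case: z => x y; apply/eqP; rewrite eq_complex /=; apply/andP; split; apply/eqP; ring. Qed.

(** A created vector is supported on the range of the injection [prepend p u]; reindexing the inner
    product along it moves the amplitude to the other argument. *)
Lemma is_adjoint_creation b p q u : is_adjoint (creation b p q u) (annihilation b p q u).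
Proof.
move=> f g; rewrite /dot (csum_image (prepend_inj (p := p) (u := u))).
  congr csum; apply/funext => -[s q0].
  rewrite /= /annihilation_fun eqxx /=.
  case: ifP => _; last by rewrite mul0r conjc0 mulr0.
  by rewrite conjc_scale mulrCA mulrA.
move=> [[|x s] q0] h /=; first by rewrite mul0r.
case: ifP; last by rewrite mul0r.
by case/andP => /eqP xE _; case: h; exists (s, q0) => //; rewrite /prepend /= xE.
Qed.

Definition sym_annihilation b (p q : 'I_r) (u : 'I_k) : fock -> fock :=
  if p == q then annihilation b q q u
  else fun f => annihilation b p q u f + annihilation b q p u f.

Lemma is_adjoint_sym_creation b p q u :
  is_adjoint (sym_creation b p q u) (sym_annihilation b p q u).
Proof.
rewrite /sym_creation /sym_annihilation; case: eqP => _; first exact: is_adjoint_creation.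
exact: is_adjointD (@is_adjoint_creation _ _ _ _) (@is_adjoint_creation _ _ _ _).
Qed.

(** For [p] different from [q] at most one of the two summands is nonzero at a given tensor, so
    [mask] treats this case and the diagonal one alike. *)
Lemma sym_creationE b p q u f x s q0 : sym_creation b p q u f (x :: s, q0) =
  ((x.2 == u) && mask p q x.1 (head_index (s, q0)))%:R *
  (Num.sqrt (b x.1 (head_index (s, q0)) u))%:C * f (s, q0).
Proof.
case: x => x1 x2; rewrite /sym_creation /mask /=.
have addE (f1 f2 : fock) w : (f1 + f2) w = f1 w + f2 w by [].
have [->|pq] := eqVneq p q.
  rewrite /= xpair_eqE orbb.
  case: (eqVneq x1 q) => [->|_]; case: (eqVneq x2 u) => [_|_];
    case: (eqVneq (head_index (s, q0)) q) => [->|_];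
    by rewrite /= ?mul1r ?mul0r.
rewrite addE /= !xpair_eqE.
case: (eqVneq x2 u) => [_|_]; last by rewrite !andbF !mul0r addr0.
case: (eqVneq x1 p) => [->|x1p] /=.
  rewrite (negbTE pq) /= orbF.
  by case: (eqVneq (head_index (s, q0)) q) => [->|_]; rewrite ?mul1r ?mul0r addr0.
case: (eqVneq x1 q) => [->|x1q] /=.
  by case: (eqVneq (head_index (s, q0)) p) => [->|_]; rewrite ?mul1r ?mul0r add0r.
by rewrite !mul0r addr0.
Qed.

Lemma sym_creation_vacuum b p q u f q0 : sym_creation b p q u f ([::], q0) = 0.
Proof.
have addE (f1 f2 : fock) w : (f1 + f2) w = f1 w + f2 w by [].
by rewrite /sym_creation; case: eqP => _; rewrite ?addE /= ?addr0.
Qed.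

(** At most one index [a] contributes, the partner of the head of [w] in the pair p, q; the sum has
    the shape of the sum over colours in the loop equation. *)
Lemma sym_annihilationE b p q u f w : sym_annihilation b p q u f w =
  \sum_a (mask p q a (head_index w))%:R * (Num.sqrt (b a (head_index w) u))%:C * f (prepend a u w).
Proof.
have addE (f1 f2 : fock) w' : (f1 + f2) w' = f1 w' + f2 w' by [].
have sum1 a h (F : 'I_r -> C) : \sum_a' ((a' == a) && h)%:R * F a' = h%:R * F a.
  rewrite (bigD1 a)//= eqxx big1 ?addr0// => a' /negbTE ->.
  by rewrite mul0r.
rewrite /sym_annihilation /mask; under eq_bigr do rewrite -mulrA.
have [->|pq] := eqVneq p q.
  under eq_bigr do rewrite orbb.
  rewrite sum1 /= /annihilation_fun.
  by case: eqP => [->|_]; rewrite ?mul1r ?mul0r.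
rewrite addE /= /annihilation_fun.
have [hq|hq] := eqVneq (head_index w) q.
  rewrite (eq_bigr (fun a => ((a == p) && true)%:R * ((Num.sqrt (b a q u))%:C * f (prepend a u w)))).
    by rewrite sum1 mul1r hq eq_sym (negbTE pq) addr0.
  by move=> a _; rewrite hq (eq_sym q p) (negbTE pq) andbT andbF orbF.
have [hp|hp] := eqVneq (head_index w) p.
  rewrite (eq_bigr (fun a => ((a == q) && true)%:R * ((Num.sqrt (b a p u))%:C * f (prepend a u w)))).
    by rewrite sum1 mul1r add0r.
  by move=> a _; rewrite hp andbF.
rewrite addr0 big1// => a _; by rewrite !andbF mul0r.
Qed.

End annihilation.

(** * Recursion for the vacuum moments *)

Section vacuum_coefficients.
Local Open Scope complex_scope.
Variables (R : realType) (r t : nat) (d : 'I_r -> R) (v : 'I_t -> 'M[R]_r).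
Local Notation word_type := (seq (letter r t)).
Local Notation label := ('I_t.*2).
Local Notation basis := (seq ('I_r * label) * 'I_r)%type.
Local Notation fock := (fock R r t.*2).

(** An operator with exponent [e] creates particles with [label_of e u] and annihilates those with
    [label_of (~~ e) u], so a pairing joins opposite exponents. *)
Definition label_of (e : bool) (u : 'I_t) : label := if e then even_label u else odd_label u.

Lemma half_label_of e u : half_label (label_of e u) = u.
Proof. by apply/val_inj; case: e; rewrite /= ?uphalf_double ?doubleK. Qed.

Lemma label_of_inj e u e' u' : (label_of e u == label_of e' u') = (e == e') && (u == u').
Proof.
apply/eqP/andP => [h|[/eqP -> /eqP ->]//].
split; last by rewrite -(half_label_of e u) h half_label_of.
by move: h => /(congr1 (odd \o val)); case: e e' => -[] //=; rewrite !odd_double.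
Qed.

Let amp (u : 'I_t) (a b : 'I_r) : R := Num.sqrt (d a * v u a b).

(* The coefficient at the basis vector (s, q) of the image of Omega_c under [W]. *)
Fixpoint fock_coef (c : 'I_r) (W : word_type) (s : seq ('I_r * label)) (q : 'I_r) : R :=
  match W with
  | [::] => ((s == [::]) && (q == c))%:R
  | inl a :: W' => (head_index (s, q) == a)%:R * fock_coef c W' s q
  | inr (u, e, p, p') :: W' =>
    (if s is x :: s' then
       ((x.2 == label_of e u) && mask p p' x.1 (head_index (s', q)))%:R *
         amp u x.1 (head_index (s', q)) * fock_coef c W' s' q
     else 0) +
    \sum_b (mask p p' b (head_index (s, q)))%:R * amp u b (head_index (s, q)) *
      fock_coef c W' ((b, label_of (~~ e) u) :: s) q
  end.

Definition vacuum_coef c W := fock_coef c W [::] c.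

Lemma eta_powE e p q u (f : fock) w : eta_pow e d v p q u f w =
  sym_creation (Defs.covariance d v) p q (label_of e u) f w +
  sym_annihilation (Defs.covariance d v) p q (label_of (~~ e) u) f w.
Proof.
have etaE : Defs.eta d v p q u = fun g => sym_creation (Defs.covariance d v) p q (odd_label u) g +
    sym_annihilation (Defs.covariance d v) p q (even_label u) g.
  apply/funext => g; rewrite /Defs.eta.
  by rewrite (adjointE (@is_adjoint_sym_creation _ _ _ (Defs.covariance d v) p q (even_label u))).
rewrite /eta_pow etaE; case: e => //.
rewrite (adjointE (B := fun g => sym_annihilation (Defs.covariance d v) p q (odd_label u) g +
    sym_creation (Defs.covariance d v) p q (even_label u) g)).
  by rewrite [LHS]addrC.
apply: is_adjointD; first exact: is_adjoint_sym_creation.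
exact/is_adjoint_sym/is_adjoint_sym_creation.
Qed.

Lemma eta_prod_vacuum m (eps : 'I_m -> bool) (u : 'I_m -> 'I_t) (p1 q1 : 'I_m -> 'I_r) c w :
  (\big[comp/idfun]_(k < m) eta_pow (eps k) d v (p1 k) (q1 k) (u k)) (vacuum R t.*2 c) w =
  (fock_coef c [seq inr (u k, eps k, p1 k, q1 k) | k <- index_enum 'I_m] w.1 w.2)%:C.
Proof.
elim: (index_enum 'I_m) w => [|k s IH] [s' q].
  by rewrite big_nil /= /vacuum /= xpair_eqE rmorph_nat.
rewrite big_cons /= eta_powE sym_annihilationE rmorphD rmorph_sum /=; congr (_ + _).
  case: s' => [|x s'] /=; first by rewrite sym_creation_vacuum.
  rewrite sym_creationE IH /= !rmorphM rmorph_nat /= /amp /Defs.covariance.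
  by rewrite half_label_of.
apply: eq_bigr => b _; rewrite IH /= !rmorphM rmorph_nat /= /amp /Defs.covariance.
by rewrite half_label_of.
Qed.

Lemma Psi_fock_coef m (eps : 'I_m -> bool) (u : 'I_m -> 'I_t) (p1 q1 : 'I_m -> 'I_r) c :
  Psi c (\big[comp/idfun]_(k < m) eta_pow (eps k) d v (p1 k) (q1 k) (u k)) =
  (vacuum_coef c [seq inr (u k, eps k, p1 k, q1 k) | k <- index_enum 'I_m])%:C.
Proof. by rewrite /Psi dot_ketr eta_prod_vacuum. Qed.

(** The amplitude with which the first letter of [W] creates the particle [x] on a vector of head
    index [h]. *)
Let pair_amp (W : word_type) (x : 'I_r * label) (h : 'I_r) : R :=
  if W is inr (u, e, p, p') :: _ then
    ((x.2 == label_of e u) && mask p p' x.1 h)%:R * amp u x.1 h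
  else 0.

Let pair_amp_take j W x h : pair_amp (take j.+1 W) x h = pair_amp W x h.
Proof. by case: W. Qed.

Let sum_triangle n (F : nat -> nat -> R) :
  \sum_(0 <= k < n) \sum_(0 <= j < n - k.+1) F k (k.+1 + j)%N =
  \sum_(0 <= i < n) \sum_(0 <= k < i) F k i.
Proof.
transitivity (\sum_(k < n) \sum_(i < n | (k < i)%N) F k i).
  rewrite big_mkord; apply: eq_bigr => k _.
  rewrite -(big_mkord (fun i => (k < i)%N) (F k)) -(big_nat_widenl _ _ _ predT)//.
  rewrite -[in RHS](add0n k.+1) [RHS]big_addn.
  by apply: eq_bigr => j _; rewrite addnC.
rewrite (exchange_big_dep predT)//= big_mkord; apply: eq_bigr => i _.
rewrite big_mkord (big_ord_widen_cond n predT (F^~ i)) 1?ltnW//.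
Qed.

(* The first particle of x :: s was created by the k-th letter of [W], and the letters
   in front of it only act on top of it. *)
Lemma fock_coef_split c W x s q : fock_coef c W (x :: s) q =
  \sum_(0 <= k < size W) vacuum_coef x.1 (take k W) *
    pair_amp (drop k W) x (head_index (s, q)) * fock_coef c (drop k.+1 W) s q.
Proof.
have [N] := ubnP (size W); elim: N c W x s q => // N IH c [|l W] x s q.
  by rewrite big_nil.
rewrite ltnS -[size (l :: W)]/(size W).+1 => WN; rewrite big_nat_recl// drop0.
have v0 : vacuum_coef x.1 (take 0 (l :: W)) = 1.
  by rewrite /vacuum_coef /= eqxx.
rewrite v0 mul1r -[drop 1 _]/(drop 0 W) drop0.
under eq_bigr => i _ do rewrite -[drop i.+1 _]/(drop i W) -[drop i.+2 _]/(drop i.+1 W)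
  -[take i.+1 _]/(l :: take i W).
move=> {v0}; case: l => [a|[[[u e] p] p']].
  rewrite mul0r add0r [LHS]/= IH// mulr_sumr; apply: eq_bigr => i _.
  by rewrite /vacuum_coef /= !mulrA.
set lab := label_of (~~ e) u.
pose G b k i := (mask p p' b x.1)%:R * amp u b x.1 * (vacuum_coef b (take k W) *
    pair_amp (drop k W) (b, lab) x.1 * (vacuum_coef x.1 (drop k.+1 (take i W)) *
    pair_amp (drop i W) x (head_index (s, q)) * fock_coef c (drop i.+1 W) s q)).
rewrite [LHS]/= -/lab; congr (_ + _).
(* The first letter annihilates a particle of index b lying on top of x. The induction hypothesis is
   used twice: the k-th letter of [W] created the upper particle, and a later one, at position i = k
   + 1 + j, created x. Exchanging the sums collects the terms of fixed i, where the hypothesis for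
   [take i W] recombines them. *)
transitivity (\sum_b \sum_(0 <= k < size W) \sum_(0 <= j < size W - k.+1) G b k (k.+1 + j)%N).
  apply: eq_bigr => b _; rewrite IH// mulr_sumr big_nat [RHS]big_nat.
  apply: eq_bigr => k /andP[_ kW].
  rewrite IH; last by rewrite size_drop (leq_ltn_trans _ WN)// leq_subr.
  rewrite size_drop !mulr_sumr; apply: eq_bigr => j _.
  by rewrite /G (addnC k.+1) take_drop !drop_drop.
rewrite (eq_bigr _ (fun b _ => sum_triangle (size W) (G b))).
rewrite exchange_big/= big_nat [RHS]big_nat; apply: eq_bigr => i /andP[_ iW].
have -> : vacuum_coef x.1 (inr (u, e, p, p') :: take i W) = \sum_b
    (mask p p' b x.1)%:R * amp u b x.1 * fock_coef x.1 (take i W) [:: (b, lab)] x.1.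
  by rewrite /vacuum_coef /= add0r.
rewrite -mulrA mulr_suml.
apply: eq_bigr => b _; rewrite IH; last by rewrite size_takel ?(ltn_trans iW)// ltnW.
rewrite size_takel; last exact: ltnW.
rewrite mulr_sumr mulr_suml big_nat [RHS]big_nat; apply: eq_bigr => k /andP[_ ki].
rewrite take_takel; last exact: ltnW.
have -> : drop k (take i W) = take (i - k.+1).+1 (drop k W).
  by rewrite subnSK// take_drop subnK// ltnW.
by rewrite pair_amp_take /G !mulrA.
Qed.

Lemma vacuum_coef_nil c : vacuum_coef c [::] = 1.
Proof. by rewrite /vacuum_coef /= eqxx. Qed.

Lemma vacuum_coef_proj c a W : vacuum_coef c (inl a :: W) = (a == c)%:R * vacuum_coef c W.
Proof. by rewrite /vacuum_coef /= eq_sym. Qed.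

Hypothesis dv_ge0 : forall u a b, 0 <= d a * v u a b.
Hypothesis v_sym : forall u a b, v u a b = v u b a.

(** The empty tensor is never the result of a creation, so the first letter annihilates a single
    particle of some index b. [fock_coef_split] locates the letter that created it; creation and
    annihilation have the same amplitude sqrt(d_b v_{b,c}), and its square appears. *)
Lemma vacuum_coef_cons u e p q c W : vacuum_coef c (inr (u, e, p, q) :: W) =
  \sum_b (mask p q c b)%:R * v u c b * (d b *
    \sum_(0 <= k < size W) (pairs_head u e b c (drop k W))%:R *
      (vacuum_coef b (take k W) * vacuum_coef c (drop k.+1 W))).
Proof.
rewrite [LHS]/vacuum_coef [LHS]/= add0r; apply: eq_bigr => b _.
rewrite (mask_sym p q c b) -!mulrA; congr (_ * _).
rewrite fock_coef_split mulrA !mulr_sumr; apply: eq_bigr => k _.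
have -> : pair_amp (drop k W) (b, label_of (~~ e) u) c = (pairs_head u e b c (drop k W))%:R * amp u b c.
  case: (drop k W) => [|[a|[[[u' e'] p'] q']] W'] /=; rewrite ?mul0r//.
  rewrite label_of_inj; case: (eqVneq u' u) => [->|uu'].
    by congr (_%:R * _); case: e' e => -[].
  by rewrite !andbF !mul0r.
rewrite /vacuum_coef [head_index _]/= -[amp u b c]/(Num.sqrt (d b * v u b c)).
rewrite (v_sym u c b).
have := sqr_sqrtr (dv_ge0 u b c).
move: (Num.sqrt _) (pairs_head _ _ _ _ _)%:R (fock_coef _ _ _ _) (fock_coef _ _ _ _) => x y z w xE.
by rewrite mulrA (mulrC (v u b c)) -xE; ring.
Qed.

End vacuum_coefficients.

(** * The large n limit *)

Section complex_limits.
Variables (R : realType).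
Local Notation C := R[i].
Implicit Types (f g : nat -> C) (a b : C).

Lemma cvg_cstC a : (fun _ : nat => a) n @[n --> \oo] --> (a : C^o).
Proof. exact: (@cvg_cst C^o). Qed.

Lemma cvg_eqC f a b : a = b -> f n @[n --> \oo] --> (a : C^o) ->
  f n @[n --> \oo] --> (b : C^o).
Proof. by move=> ->. Qed.

Lemma cvgDC f g a b : f n @[n --> \oo] --> (a : C^o) -> g n @[n --> \oo] --> (b : C^o) ->
  (f n + g n) @[n --> \oo] --> (a + b : C^o).
Proof. exact: (@cvgD C C^o). Qed.

Lemma cvgMC f g a b : f n @[n --> \oo] --> (a : C^o) -> g n @[n --> \oo] --> (b : C^o) ->
  (f n * g n) @[n --> \oo] --> (a * b : C^o).
Proof. exact: (@cvgM C). Qed.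

Lemma cvgZC f a b : f n @[n --> \oo] --> (b : C^o) ->
  (a * f n) @[n --> \oo] --> (a * b : C^o).
Proof. by move=> fb; exact: (@cvgMC (fun=> a) f a b (@cvg_cstC a) fb). Qed.

Lemma cvg_sumC (J : Type) (s : seq J) (F : J -> nat -> C) (a : J -> C) :
  (forall j, F j n @[n --> \oo] --> (a j : C^o)) ->
  (\sum_(j <- s) F j n) @[n --> \oo] --> (\sum_(j <- s) a j : C^o).
Proof.
move=> Fa; elim: s => [|j s IH].
  by rewrite big_nil; under eq_fun do rewrite big_nil; exact: cvg_cstC.
by rewrite big_cons; under eq_fun do rewrite big_cons; exact: (cvgDC (@Fa j) IH).
Qed.

Lemma cvg_shiftC N f a :
  f (n + N)%N @[n --> \oo] --> (a : C^o) -> f n @[n --> \oo] --> (a : C^o).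
Proof. by move=> fa; rewrite -(@cvg_shiftn N C^o f (nbhs (a : C^o))); exact: fa. Qed.

Lemma cvg_real_complex (f : nat -> R) (a : R) : f n @[n --> \oo] --> a ->
  (f n)%:C%C @[n --> \oo] --> (a%:C%C : C^o).
Proof.
move=> /cvgrPdist_lt fa; apply/(@cvgrPdist_lt C C^o) => e e0.
have [r0 eE] : 0 < complex.Re e /\ e = (complex.Re e)%:C%C.
  move: e0; rewrite ltcE /= => /andP[/eqP ie re]; split => //.
  by case: e ie {re} => x y /= ->.
near=> n; rewrite -rmorphB normc_def /= expr0n /= addr0 sqrtr_sqr eE ltcR.
by near: n; exact: fa.
Unshelve. all: by end_near. Qed.

End complex_limits.

(** * Solving the loop equation in the limit *)

Section loop_limit.
Local Open Scope complex_scope.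
Variables (R : realType) (r t : nat) (d : 'I_r -> R) (v : 'I_t -> 'M[R]_r).
Hypothesis dv_ge0 : forall u a b, 0 <= d a * v u a b.
Hypothesis v_sym : forall u a b, v u a b = v u b a.
Local Notation word_type := (seq (letter r t)).
Local Notation C := R[i].
Variables (E : nat -> seq ('I_r * word_type) -> C) (nn : nat -> 'I_r -> C) (iota : nat -> C).
Hypothesis E_nil : forall n, E n [::] = 1.
Hypothesis E_nil_word : forall n c l, E n ((c, [::]) :: l) = E n l.
Hypothesis E_proj : forall n c a W l,
  E n ((c, inl a :: W) :: l) = (a == c)%:R * E n ((c, W) :: l).
Hypothesis E_loop : forall n u e p q c W l, E n ((c, inr (u, e, p, q) :: W) :: l) =
  \sum_b (mask p q c b)%:R * ((v u c b)%:C * iota n) *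
    (nn n b * loop_split (E n) u e b c W l +
    \sum_(0 <= k < size l) loop_merge (E n) (nn n) u e b c W (take 1 (drop k l)) (take k l ++ drop k.+1 l)).
Hypothesis nn_lim : forall c, (iota n * nn n c) @[n --> \oo] --> ((d c)%:C : C^o).
Hypothesis merge_lim : forall c, (iota n / nn n c) @[n --> \oo] --> (0 : C^o).

(* A merge removes one word and two blocks but inserts two projections. *)
Let letter_weight (l : letter r t) : nat := if l is inl _ then 1 else 3.
Let weight (l : seq ('I_r * word_type)) : nat :=
  \sum_(x <- l) (1 + \sum_(y <- x.2) letter_weight y).

Let word_weight (W : word_type) : nat := \sum_(y <- W) letter_weight y.

Let weight_cons c W l : weight ((c, W) :: l) = (1 + word_weight W + weight l)%N.
Proof. by rewrite /weight big_cons. Qed.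

Let weight_cat l1 l2 : weight (l1 ++ l2) = (weight l1 + weight l2)%N.
Proof. by rewrite /weight big_cat. Qed.

Let word_weight_split W k : (word_weight (take k W) + word_weight (drop k.+1 W) <= word_weight W)%N.
Proof.
rewrite -{3}(cat_take_drop k W) /word_weight big_cat leq_add2l.
rewrite -[k.+1]add1n -drop_drop; case: (drop k W) => [|y s] /=; first by rewrite big_nil.
by rewrite drop0 big_cons leq_addl.
Qed.

Theorem loop_limit l :
  E n l @[n --> \oo] --> ((\prod_(x <- l) vacuum_coef d v x.1 x.2)%:C : C^o).
Proof.
have [N] := ubnP (weight l); elim: N l => // N IH [|[c [|[a|[[[u e] p] q]] W]] l].
- by move=> _; rewrite big_nil; under eq_fun do rewrite E_nil; exact: cvg_cstC.
- rewrite ltnS weight_cons => lN; rewrite big_cons vacuum_coef_nil mul1r.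
  under eq_fun do rewrite E_nil_word; apply: IH.
  by apply: leq_trans lN; rewrite addnC addnA addn1 ltnS leq_addr.
- rewrite ltnS weight_cons /word_weight big_cons -/(word_weight W) => lN.
  under eq_fun do rewrite E_proj.
  rewrite big_cons vacuum_coef_proj -mulrA rmorphM rmorph_nat; apply: cvgZC.
  have := IH ((c, W) :: l); rewrite big_cons; apply.
  by apply: leq_trans lN; rewrite weight_cons /= !addSn !add0n.
rewrite ltnS weight_cons /word_weight big_cons -/(word_weight W) [letter_weight _]/= => lN.
under eq_fun do rewrite E_loop.
rewrite big_cons vacuum_coef_cons// mulr_suml rmorph_sum.
apply: cvg_sumC => b.
set S := \sum_(0 <= k < size W) _.
have split_lim : loop_split (E n) u e b c W l @[n --> \oo] -->
    ((S * \prod_(x <- l) vacuum_coef d v x.1 x.2)%:C : C^o).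
  rewrite /S mulr_suml rmorph_sum; apply: cvg_sumC => k.
  rewrite -!mulrA rmorphM rmorph_nat; apply: cvgZC.
  have := IH [:: (b, take k W), (c, drop k.+1 W) & l]; rewrite !big_cons; apply.
  apply: leq_trans lN; rewrite !weight_cons.
  by have := word_weight_split W k; lia.
(* The expectations of merged lists converge by the induction hypothesis, while their weights tend
   to 0. *)
have merge_lim0 : (iota n * \sum_(0 <= k < size l) loop_merge (E n) (nn n) u e b c W
    (take 1 (drop k l)) (take k l ++ drop k.+1 l)) @[n --> \oo] --> (0 : C^o).
  under eq_fun do rewrite mulr_sumr.
  apply: (cvg_eqC (a := \sum_(0 <= k < size l) 0)); first by rewrite big1.
  apply: cvg_sumC => k.
  case E1 : (drop k l) => [|[c' V] l'].
    by under eq_fun do rewrite /= mulr0; exact: cvg_cstC.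
  rewrite -[take 1 _]/((c', V) :: take 0 l') /loop_merge.
  under eq_fun do rewrite mulrA.
  apply: (cvg_eqC (a := 0 * (\sum_(0 <= j < size V) (pairs_head u e b c (drop j V))%:R *
      (\prod_(x <- (c, (drop j.+1 V ++ inl c' :: take j V) ++ inl b :: W) :: take k l ++ drop k.+1 l)
         vacuum_coef d v x.1 x.2)%:C))); first by rewrite mul0r.
  apply: cvgMC; first exact: merge_lim.
  apply: cvg_sumC => j; apply: cvgZC; apply: IH; apply: leq_trans lN.
  (* The weight 3 of the first block and the weight 1 of the word that disappears outweigh the two
     new projections, even before the block removed from [V] is counted. *)
  have lE : weight l = (weight (take k l ++ drop k.+1 l) + (1 + word_weight V))%N.
    have dk : drop k.+1 l = l' by rewrite -[k.+1]add1n -drop_drop E1 /= drop0.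
    rewrite -{1}(cat_take_drop k l) !weight_cat E1 weight_cons dk.
    lia.
  rewrite lE weight_cons /word_weight !(big_cat, big_cons) /=.
  by have := word_weight_split V j; rewrite /word_weight; lia.
(* The factor [iota n] is distributed so that it meets [nn n b] in the split term, where the product
   tends to d_b, and the whole sum in the merge term. *)
have -> : (fun n => (mask p q c b)%:R * ((v u c b)%:C * iota n) *
      (nn n b * loop_split (E n) u e b c W l + \sum_(0 <= k < size l)
       loop_merge (E n) (nn n) u e b c W (take 1 (drop k l)) (take k l ++ drop k.+1 l))) =
    (fun n => (mask p q c b)%:R * ((v u c b)%:C * (iota n * nn n b * loop_split (E n) u e b c W l +
       iota n * \sum_(0 <= k < size l)
       loop_merge (E n) (nn n) u e b c W (take 1 (drop k l)) (take k l ++ drop k.+1 l)))).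
  by apply/funext => n; rewrite -!mulrA; congr (_ * (_ * _)); rewrite mulrDr !mulrA.
rewrite -!mulrA !rmorphM rmorph_nat; do 2!apply: cvgZC.
apply: (cvg_eqC (addr0 _)); apply: cvgDC; last exact: merge_lim0.
rewrite -rmorphM; apply: cvgMC; [exact: nn_lim|exact: split_lim].
Qed.

End loop_limit.

(** * Gaussian matrices *)

Section wirtinger.
Variables (C : comNzRingType) (N : nat).

(** If [k1] and [k2] index the real and imaginary parts of z, then s = i gives a multiple of the
    derivative in the conjugate of z, and s = -i one of the derivative in z. *)
Definition wirtinger (k1 k2 : 'I_N) (c s : C) (p : mpoly N C) : mpoly N C :=
  c *: (mderiv k1 p + s *: mderiv k2 p).

Lemma wirtinger_is_linear k1 k2 c s : linear (wirtinger k1 k2 c s).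
Proof.
have scaleC (b e : C) (x : mpoly N C) : b *: (e *: x) = e *: (b *: x).
  by rewrite !scalerA mulrC.
move=> a p q; rewrite /wirtinger !mderivD !mderivZ [s *: _]scalerDr (scaleC s) addrACA.
by rewrite scalerDr -[a *: _ + _]scalerDr scaleC.
Qed.

HB.instance Definition _ k1 k2 c s :=
  GRing.isLinear.Build C (mpoly N C) (mpoly N C) *:%R (wirtinger k1 k2 c s)
    (wirtinger_is_linear k1 k2 c s).

Lemma wirtingerM k1 k2 c s p q :
  wirtinger k1 k2 c s (p * q) = wirtinger k1 k2 c s p * q + p * wirtinger k1 k2 c s q.
Proof.
rewrite /wirtinger !mderivM -scalerAl -scalerAr -scalerDr; congr (_ *: _).
by rewrite mulrDl mulrDr [s *: (_ + _)]scalerDr -scalerAl -scalerAr addrACA.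
Qed.

Lemma mderiv_var (k j : 'I_N) : mderiv k (mpolyX C (mnm1 j)) = (k == j)%:R :> mpoly N C.
Proof.
rewrite mderivX mnm1E eq_sym; case: eqP => [->|_]; last by rewrite scale0r.
rewrite scale1r (_ : mnm_sub _ _ = mnm0) ?mpolyX0//.
by apply/mnmP => x; rewrite mnmBE mnm0E subnn.
Qed.

End wirtinger.

Section gaussian_matrices.
Local Open Scope complex_scope.
Context d (T : measurableType d) (R : realType) (P : probability T R).
Variables (n r t : nat) (cl : 'I_n -> 'I_r) (v : 'I_t -> 'M[R]_r).
Variable Y : 'I_t -> T -> 'M[R[i]]_n.
Hypothesis n_gt0 : (0 < n)%N.
Hypothesis v_sym : forall u a b, v u a b = v u b a.
Local Notation I := ('I_t * 'I_n * 'I_n * bool)%type.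
Let X (x : I) : T -> R := let: (u, i, j, b) := x in entry_part b (Y u) i j.
Let w (x : I) : R := let: (u, i, j, b) := x in v u (cl i) (cl j) / (2 * n%:R).
Hypothesis indepX : mutually_independent P X.
Hypothesis gaussX : forall x, [/\ gaussian P (X x), ('E_P[X x] = 0)%E &
  ('E_P[fun z => (X x z ^+ 2)%R] = (w x)%:E)%E].
Local Notation poly := (mpoly #|{: I}| R[i]).

Let mX x : measurable_fun [set: T] (X x).
Proof. by have [[]] := gaussX x. Qed.

Let momX x k : P.-integrable [set: T] (EFin \o (fun z => X x z ^+ k)) /\
  \int[P]_z X x z ^+ k.+1 = k%:R * w x * \int[P]_z X x z ^+ k.-1.
Proof. by have [g e0 e2] := gaussX x; exact: gaussian_moments. Qed.

Let L (p : poly) : R[i] := poly_expectation P X p.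

Let L_is_linear : linear_for *%R L.
Proof. exact: poly_expectation_is_linear mX indepX momX. Qed.

HB.instance Definition _ := GRing.isLinear.Build R[i] poly R[i] *%R L L_is_linear.

(** The indices are exchanged for [e] because the entry (i, j) of the adjoint is the conjugate of
    the entry (j, i). *)
Let rank (e : bool) (u : 'I_t) (i j : 'I_n) (b : bool) : 'I_#|{: I}| :=
  enum_rank (if e then (u, j, i, b) else (u, i, j, b)).

Let sgn (e : bool) : R[i] := if e then - 'i else 'i.

Definition entry_poly (e : bool) u i j : poly :=
  mpolyX R[i] (mnm1 (rank e u i j false)) +
  sgn e *: mpolyX R[i] (mnm1 (rank e u i j true)).

(* For a complex Gaussian z = x + iy this is E|z|^2 times the derivative with
   respect to the conjugate of z. *)
Definition entry_deriv (e : bool) u i j : {linear poly -> poly} :=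
  wirtinger (rank e u i j false) (rank e u i j true)
    (v u (cl i) (cl j) / (2 * n%:R))%:C (sgn e).

Let sigma (u : 'I_t) (a b : 'I_r) : R[i] := (v u a b)%:C * n%:R^-1.

Lemma entry_derivM e u i j f g : entry_deriv e u i j (f * g) =
  entry_deriv e u i j f * g + f * entry_deriv e u i j g.
Proof. exact: wirtingerM. Qed.

Let rank_inj e u i j b e' u' k l b' : (rank e u i j b == rank e' u' k l b') =
  [&& b == b', u == u' & if e == e' then (i == k) && (j == l) else (i == l) && (j == k)].
Proof.
rewrite (inj_eq enum_rank_inj); case: e e' => -[] /=; rewrite !xpair_eqE;
  by case: (b == b') (u == u') (i == _) (j == _) => -[] -[] -[].
Qed.

(** On the same matrix entry the value is the variance v/(2n) times 1 + s s', where s and s' are i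
    or -i. This sum is 0 for equal exponents and 2 for opposite ones, which leaves v/n. *)
Lemma entry_deriv_entry e u i j e' u' k l : entry_deriv e u i j (entry_poly e' u' k l) =
  [&& u' == u, e' != e, k == j & l == i]%:R *: (sigma u (cl i) (cl j))%:A.
Proof.
rewrite /entry_deriv /= /wirtinger /entry_poly !mderivD !mderivZ !mderiv_var !rank_inj /=.
rewrite scaler0 addr0 add0r.
have comb (a b c : R[i]) (x : poly) : a *: (x + b *: (c *: x)) = (a * (1 + b * c)) *: x.
  by rewrite -scalerA scalerDl scale1r scalerA.
have i2 : 'i * 'i = -1 :> R[i] by rewrite -expr2 sqrCi.
rewrite comb; case: (eqVneq e e') => [->|ee'].
  have -> : sgn e' * sgn e' = -1 by rewrite /sgn; case: e' => //; rewrite mulrNN.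
  by rewrite subrr mulr0 !scale0r !andbF scale0r.
have -> : sgn e * sgn e' = 1.
  by rewrite /sgn; case: e e' ee' => -[]//=; rewrite ?mulrN ?mulNr i2 opprK.
rewrite eq_sym (eq_sym k) (eq_sym l) (andbC (j == k)).
case: [&& u' == u, _ & _]; last by rewrite scaler0 scale0r.
rewrite scale1r; congr (_ *: _).
have -> : 1 + 1 = 2%:R :> R[i] by [].
rewrite /sigma -!(rmorph_nat (real_complex R)) -fmorphV -!rmorphM/=; congr (_%:C).
by field; rewrite pnatr_eq0 -lt0n.
Qed.

(** The real and imaginary parts of an entry have the same variance, so their two integrations by
    parts combine into [entry_deriv]. For an adjoint the variance is that of the transposed
    position, which is the same as [v] is symmetric. *)
Lemma entry_integration_by_parts e u i j f :
  L (entry_poly e u i j * f) = L (entry_deriv e u i j f).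
Proof.
have ibp := gaussian_integration_by_parts mX indepX momX.
have wE b : w (if e then (u, j, i, b) else (u, i, j, b)) = v u (cl i) (cl j) / (2 * n%:R).
  by case: e => //=; rewrite v_sym.
have ED := poly_expectationD mX indepX momX; have EZ := poly_expectationZ mX indepX momX.
rewrite /L mulrDl -scalerAl ED EZ !ibp !wE [RHS]EZ ED EZ.
by rewrite mulrDr mulrCA.
Qed.

Local Notation nn c := (#|[pred i | cl i == c]|%:R : R[i]).
Hypothesis nn0 : forall c, nn c != 0.

Definition ntraces_expectation l : R[i] := L (ntraces cl entry_poly l).

Lemma ntraces_expectation_loop u e p q c W l :
  ntraces_expectation ((c, inr (u, e, p, q) :: W) :: l) =
  \sum_b (mask p q c b)%:R * sigma u c b *
    (nn b * loop_split ntraces_expectation u e b c W l +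
     \sum_(0 <= k < size l) loop_merge ntraces_expectation (fun c => nn c)
       u e b c W (take 1 (drop k l)) (take k l ++ drop k.+1 l)).
Proof. exact: (loop_equation entry_derivM entry_deriv_entry entry_integration_by_parts nn0). Qed.

Lemma ntraces_expectation_nil : ntraces_expectation [::] = 1.
Proof. by rewrite /ntraces_expectation /ntraces big_nil; exact: poly_expectation1. Qed.

Lemma ntraces_expectation_nil_word c l :
  ntraces_expectation ((c, [::]) :: l) = ntraces_expectation l.
Proof. by rewrite /ntraces_expectation ntraces_nil. Qed.

Lemma ntraces_expectation_proj c a W l : ntraces_expectation ((c, inl a :: W) :: l) =
  (a == c)%:R * ntraces_expectation ((c, W) :: l).
Proof. by rewrite /ntraces_expectation ntraces_proj; exact: poly_expectationZ mX indepX momX _ _. Qed.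

Variable N : 'I_r -> {set 'I_n}.
Hypothesis clE : forall i p, (cl i == p) = (i \in N p).

(** For [p] different from [q] the supports of the two summands of a block are disjoint, and their
    indicators add up to [mask]; its symmetry handles the adjoint. *)
Lemma block_powE e p q (M : 'M[R[i]]_n) i j : block_pow N e p q M i j =
  (mask p q (cl i) (cl j))%:R * (if e then conjc (M j i) else M i j).
Proof.
have sE k l : sym_block N p q M k l = (mask p q (cl k) (cl l))%:R * M k l.
  rewrite /sym_block /block_proj /mask !clE.
  have PE a b : (diag_mx (\row_j (j \in N a)%:R) *m M *m diag_mx (\row_j (j \in N b)%:R)) k l =
    ((k \in N a) && (l \in N b))%:R * M k l.
    rewrite mul_mx_diag mul_diag_mx !mxE mulrAC -natrM mulnb.
    by [].
  have [->|pq] := eqVneq p q; first by rewrite PE orbb.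
  rewrite mxE !PE -mulrDl -!clE; congr (_ * _).
  case: (eqVneq (cl k) p) => [->|_]; first by rewrite (negbTE pq) addr0 orbF.
  by rewrite add0r.
rewrite /block_pow; case: e; rewrite ?mxE sE// rmorphM rmorph_nat.
by rewrite /mask orbC (andbC (cl i == q)) (andbC (cl i == p)).
Qed.

Lemma poly_eval_entry x e u i j : poly_eval X x (entry_poly e u i j) =
  if e then conjc (Y u x j i) else Y u x i j.
Proof.
rewrite /poly_eval /entry_poly mevalD mevalZ !mevalXU !enum_rankK /sgn -complexiE.
case: e; rewrite /= /entry_part; case: (Y u x _ _) => a b; apply/eqP; rewrite eq_complex/=.
  by apply/andP; split; apply/eqP; ring.
by apply/andP; split; apply/eqP; ring.
Qed.

Lemma poly_eval_word (J : Type) (s : seq J) (eps : J -> bool) (p1 q1 : J -> 'I_r)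
    (u : J -> 'I_t) x i j :
  poly_eval X x (word_mx cl entry_poly [seq inr (u k, eps k, p1 k, q1 k) | k <- s] i j) =
  (\prod_(k <- s) block_pow N (eps k) (p1 k) (q1 k) (Y (u k) x)) i j.
Proof.
elim: s i j => [|k s IH] i j.
  by rewrite big_nil /poly_eval /word_mx /= !mxE rmorph_nat.
rewrite big_cons /= !mxE.
rewrite /poly_eval rmorph_sum; apply: eq_bigr => h _.
rewrite rmorphM -/(poly_eval _ _ _) -(IH h j); congr (_ * _).
by rewrite mxE block_powE -(poly_eval_entry x); exact: mevalZ.
Qed.

Lemma tau_ntraces q m (eps : 'I_m -> bool) (p1 q1 : 'I_m -> 'I_r) (u : 'I_m -> 'I_t) :
  tau P (N q) (fun x => \prod_(k < m) block_pow N (eps k) (p1 k) (q1 k) (Y (u k) x)) =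
  ntraces_expectation [:: (q, [seq inr (u k, eps k, p1 k, q1 k) | k <- index_enum 'I_m])].
Proof.
have NE : N q =i [pred i | cl i == q] by move=> i; rewrite !inE clE.
rewrite /ntraces_expectation /ntraces big_seq1 /ntrace/=.
rewrite /L (poly_expectationZ mX indepX momX) /tau (eq_card NE); congr (_ * _).
rewrite /poly_expectation; congr (cexpectation P _); apply/funext => x.
rewrite [RHS]rmorph_sum (eq_bigl _ _ NE); apply: eq_bigr => j _.
by rewrite -poly_eval_word.
Qed.

End gaussian_matrices.

Theorem theorem8p1 (R : realType) (r t : nat)
  (N : forall n : nat, 'I_r -> {set 'I_n})
  (d : 'I_r -> R) (v : 'I_t -> 'M[R]_r)
  (disp : nat -> measure_display)
  (T : forall n : nat, measurableType (disp n))
  (P : forall n : nat, probability (T n) R)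
  (Y : forall n : nat, 'I_t -> T n -> 'M[R[i]]_n)
  (N_partition : forall n, (r <= n)%N -> interval_partition (N n))
  (N_dim : forall q, (#|N n q|%:R / n%:R : R) @[n --> \oo] --> d q)
  (v_sym : forall u, (v u)^T = v u)
  (Y_indep : forall n, (r <= n)%N ->
    mutually_independent (P n)
      (fun x : 'I_t * 'I_n * 'I_n * bool =>
         let: (u, i, j, b) := x in entry_part b (Y n u) i j))
  (Y_gaussian : forall n, (r <= n)%N ->
    forall p q (i j : 'I_n) (u : 'I_t) (b : bool), i \in N n p -> j \in N n q ->
      [/\ gaussian (P n) (entry_part b (Y n u) i j),
          ('E_(P n)[entry_part b (Y n u) i j] = 0)%E &
          ('E_(P n)[fun x => (entry_part b (Y n u) i j x ^+ 2)%R] = (v u p q / (2 * n%:R))%:E)%E])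
  (m : nat) (eps : 'I_m -> bool) (u : 'I_m -> 'I_t)
  (q : 'I_r) (p1 q1 : 'I_m -> 'I_r) :
  tau (P n) (N n q)
    (fun x => \prod_(k < m)
       block_pow (N n) (eps k) (p1 k) (q1 k) (Y n (u k) x)) @[n --> \oo]
  --> (Psi q (\big[comp/idfun]_(k < m)
              eta_pow (eps k) d v (p1 k) (q1 k) (u k)) : R[i]^o).
Proof.
have r_gt0 : (0 < r)%N by exact: leq_ltn_trans (leq0n _) (ltn_ord q).
(* The colour of an index. The default [q] never occurs for r <= n, where the intervals cover
   everything. *)
pose cl n (i : 'I_n) := odflt q [pick p | i \in N n p].
have clE n : (r <= n)%N -> forall i p, (cl n i == p) = (i \in N n p).
  move=> /N_partition[_ Ndisj Ncov _] i p; rewrite /cl.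
  case: pickP => [p' ip' /=|iN]; last by have [p'] := Ncov i; move: (iN p') => ->.
  apply/eqP/idP => [<- //|ip]; apply/eqP/negP => pp'.
  by have /setP/(_ i) := Ndisj _ _ (introN idP pp'); rewrite !inE ip ip'.
have cardE n c : (r <= n)%N -> #|[pred i | cl n i == c]| = #|N n c|.
  by move=> rn; apply: eq_card => i; rewrite !inE clE.
have cardN n c : (r <= n)%N -> (0 < #|N n c|)%N.
  by move=> /N_partition[N0 _ _ _]; rewrite card_gt0.
have vE u' a b : v u' a b = v u' b a by rewrite -{1}v_sym mxE.
have gaussX n : (r <= n)%N -> forall x : 'I_t * 'I_n * 'I_n * bool,
    let X := fun x => let: (u, i, j, b) := x in entry_part b (Y n u) i j in
    [/\ gaussian (P n) (X x), ('E_(P n)[X x] = 0)%E &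
      ('E_(P n)[fun z => (X x z ^+ 2)%R] =
        (let: (u, i, j, b) := x in v u (cl n i) (cl n j) / (2 * n%:R))%:E)%E].
  by move=> rn [[[u' i] j] b]; apply: Y_gaussian => //; rewrite -clE.
(* Each [v u' a b] is a positive multiple of a second moment: in dimension [r], the smallest one
   covered by the hypotheses, the intervals are nonempty and provide an entry of colours a and b. *)
have v_ge0 u' a b : 0 <= v u' a b.
  have /card_gt0P[i ia] := cardN r a (leqnn r).
  have /card_gt0P[j jb] := cardN r b (leqnn r).
  have [_ _ E2] := Y_gaussian r (leqnn r) a b i j u' false ia jb.
  have : (0 <= (v u' a b / (2 * r%:R))%:E)%E.
    by rewrite -E2; apply: expectation_ge0 => x; exact: sqr_ge0.
  by rewrite lee_fin pmulr_lge0// invr_gt0 mulr_gt0// ltr0n.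
have d_ge0 a : 0 <= d a.
  rewrite -(cvg_lim _ (N_dim a))//; apply: limr_ge; first by apply/cvg_ex; exists (d a).
  by apply: nearW => n; rewrite divr_ge0.
(* Fewer than [r] indices admit no partition into [r] nonempty intervals, so all limits are taken
   along the dimensions [n + r]. *)
have rD n : (r <= n + r)%N by rewrite leq_addl.
have nn_lim c : ((n + r)%:R^-1 * #|[pred i | cl (n + r)%N i == c]|%:R) @[n --> \oo] -->
    ((d c)%:C%C : R[i]^o).
  have := N_dim c; rewrite -(@cvg_shiftn r R _ (nbhs (d c))) => /cvg_real_complex.
  under eq_fun do rewrite fmorph_div !rmorph_nat mulrC -cardE//.
  exact.
have merge_lim c : ((n + r)%:R^-1 / #|[pred i | cl (n + r)%N i == c]|%:R) @[n --> \oo] -->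
    (0 : R[i]^o).
  have : ((n + r)%:R^-1 / #|N (n + r)%N c|%:R : R) @[n --> \oo] --> (0 : R).
    (* Nonemptiness of the interval and r >= 1 bound the weight by 1/(n + 1), also when [d c] is
       0. *)
    apply: (@squeeze_cvgr _ _ _ _ (fun=> 0) harmonic); last 2 first.
    - exact: cvg_cst.
    - exact: cvg_harmonic.
    apply: nearW => n; rewrite divr_ge0 ?invr_ge0//= ler_pdivrMr ?ltr0n ?cardN//.
    apply: (@le_trans _ _ n.+1%:R^-1).
      rewrite lef_pV2 ?posrE ?ltr0n ?addn_gt0 ?r_gt0 ?orbT// ler_nat.
      by rewrite -addn1 leq_add2l.
    by rewrite ler_peMr ?invr_ge0// ler1n cardN.
  move=> /cvg_real_complex.
  under eq_fun do rewrite fmorph_div fmorphV !rmorph_nat -cardE//.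
  exact.
apply: (@cvg_shiftC R r); rewrite Psi_fock_coef.
under eq_fun do rewrite (tau_ntraces (Y_indep _ (rD _)) (gaussX _ (rD _)) (clE _ (rD _))).
set W := [seq _ | k <- _].
have /= -> : vacuum_coef d v q W = \prod_(x <- [:: (q, W)]) vacuum_coef d v x.1 x.2.
  by rewrite big_seq1.
have nn0 n c : #|[pred i | cl (n + r)%N i == c]|%:R != 0 :> R[i].
  by rewrite pnatr_eq0 cardE// -lt0n cardN.
have limit dv_ge0 E_nil E_nil_word E_proj E_loop := @loop_limit R r t d v dv_ge0 vE
  (fun n => ntraces_expectation (P (n + r)%N) (cl (n + r)%N) (Y (n + r)%N)) _ _
  E_nil E_nil_word E_proj E_loop nn_lim merge_lim [:: (q, W)].
apply: limit => [u' a b|n|n c l|n c a W' l|n u' e p q' c W' l].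
- by rewrite mulr_ge0.
- exact: ntraces_expectation_nil.
- exact: ntraces_expectation_nil_word.
- exact: (ntraces_expectation_proj (Y_indep _ (rD n)) (gaussX _ (rD n))).
apply: (ntraces_expectation_loop _ vE (Y_indep _ (rD n)) (gaussX _ (rD n)) (nn0 n)).
by rewrite addn_gt0 r_gt0 orbT.
Qed.
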